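(* The finitely generated abelian groups that can be realized (up to isomorphism) as the group of units $A^*$ of an integral domain $A$ of characteristic zero which is integral over $\mathbb{Z}$ are exactly the groups of the form $C_{2n}\times\mathbb{Z}^g$, with integers $n\ge1$, $g\ge0$ such that $\phi(2n)\mid 2(g+1)$.
   Context: $A^*$ is the group of units of $A$; $C_m$ is the cyclic group of order $m$; $\phi$ is Euler's totient function. ''Integral over $\mathbb{Z}$'' means that $A$ contains $\mathbb{Z}$ as a subring and every element of $A$ is a root of a monic polynomial with coefficients in $\mathbb{Z}$. *)

(* Defs.v *)
From HB Require Import structures.
From mathcomp Require Import all_boot all_order all_algebra.

Set Implicit Arguments.
Unset Strict Implicit.
Unset Printing Implicit Defensive.

Import GRing.Theory.

Local Open Scope ring_scope.

(* MathComp's {unit R} is restricted to finite rings. *)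
Inductive unit_group (R : unitRingType) : Type :=
  UnitGroup (x : R) of x \is a GRing.unit.

Section UnitGroup.
Variable R : unitRingType.
Implicit Types u v w : unit_group R.

Definition ugval u : R := let: UnitGroup x _ := u in x.

HB.instance Definition _ := [isSub for ugval].
HB.instance Definition _ := [Choice of unit_group R by <:].

Lemma ugvalP u : ugval u \is a GRing.unit.
Proof. exact: (valP u). Qed.

Lemma ug_mul_proof u v : ugval u * ugval v \is a GRing.unit.
Proof. by rewrite unitrMr ugvalP. Qed.

Lemma ug_inv_proof u : (ugval u)^-1 \is a GRing.unit.
Proof. by rewrite unitrV ugvalP. Qed.

Definition ug_one : unit_group R := UnitGroup (unitr1 R).
Definition ug_mul u v : unit_group R := UnitGroup (ug_mul_proof u v).
Definition ug_inv u : unit_group R := UnitGroup (ug_inv_proof u).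

Lemma ug_mulA : associative ug_mul.
Proof. by move=> u v w; apply: val_inj; rewrite /= mulrA. Qed.

Lemma ug_mul1 : left_id ug_one ug_mul.
Proof. by move=> u; apply: val_inj; rewrite /= mul1r. Qed.

Lemma ug_mulr1 : right_id ug_one ug_mul.
Proof. by move=> u; apply: val_inj; rewrite /= mulr1. Qed.

Lemma ug_mulV : left_inverse ug_one ug_inv ug_mul.
Proof. by move=> u; apply: val_inj; rewrite /= mulVr ?ugvalP. Qed.

Lemma ug_mulrV : right_inverse ug_one ug_inv ug_mul.
Proof. by move=> u; apply: val_inj; rewrite /= mulrV ?ugvalP. Qed.

HB.instance Definition _ := isGroup.Build (unit_group R)
  ug_mulA ug_mul1 ug_mulr1 ug_mulV ug_mulrV.

End UnitGroup.

Definition isomorphic (G H : groupType) : Prop :=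
  exists f : {multiplicative G -> H}, bijective f.

Definition commutative_group (G : groupType) : Prop :=
  forall x y : G, commute x y.

Definition is_subgroup (G : groupType) (P : G -> Prop) : Prop :=
  [/\ P 1%g, forall x y, P x -> P y -> P (x * y)%g & forall x, P x -> P x^-1%g].

Definition finitely_generated (G : groupType) : Prop :=
  exists s : seq G, forall P : G -> Prop,
    is_subgroup P -> (forall x, x \in s -> P x) -> forall x, P x.

Definition integral_over_Z (A : nzRingType) : Prop :=
  injective (intr : int -> A) /\ integralRange (intr : int -> A).

Definition realizable (G : groupType) : Prop :=
  exists A : idomainType,
    [/\ [pchar A] =i pred0, integral_over_Z A
      & isomorphic (unit_group A : groupType) G].

(* C_(2n) x Z^g, written additively and then read multiplicatively.  This is
   the intended group only for n >= 1, since 'Z_0 is Z/2. *)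
Definition C2n_Zg (n g : nat) : groupType :=
  Algebra.to_multiplicative ('Z_(2 * n) * 'rV[int]_g)%type.

(* Main.v *)
Require Import Defs.
From HB Require Import structures.
From mathcomp Require Import all_boot all_order all_algebra all_field.
From mathcomp Require Import all_fingroup all_solvable all_character.
From mathcomp Require Import zify ring lra.
From Stdlib Require Import Classical ClassicalEpsilon.

(* Let [B] be a ring generated over [Z] by an algebraic integer of degree
   [2 (r + 1)] without real conjugates.  Dirichlet's unit theorem holds for every
   group of units lying between those of [B] and those of the integers of its
   fraction field: such a group is finitely generated, of rank [r].  Logarithms
   are avoided.  For the upper bound, absolute values are sorted by powers of 2
   and units counted in boxes; for the lower bound, Dirichlet's box principle
   gives, for each complex place, a sequence of elements of [B] of bounded norm
   that decreases at all the other places, and two members of it congruent modulo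
   a suitable integer have a unit as quotient.

   If [A^*] is finitely generated, it generates an order of a number field [K],
   of degree [d] say.  A root of unity of order [2n > 2] makes [K] totally
   complex, so that [d = 2 (g + 1)], and [phi(2n)] divides [d] since [K] contains
   the cyclotomic field.  Conversely, abelian Galois theory inside a cyclotomic
   field gives a totally complex [K] of degree [2 (g + 1)] containing
   [zeta_2n]; the integers of [K] congruent modulo 3 to all their conjugates
   over [Q(zeta_2n)] form a ring of unit rank [g], and its roots of unity are
   those of [Q(zeta_2n)] because distinct roots of unity are not congruent
   modulo 3. *)

Set Implicit Arguments.
Unset Strict Implicit.
Unset Printing Implicit Defensive.

Import Order.TTheory GRing.Theory Num.Theory.

Local Open Scope ring_scope.

(** * Box principle and finitely generated abelian groups *)

Lemma pigeonhole (I J : finType) (f : I -> J) :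
  (#|J| < #|I|)%N -> exists x y, x != y /\ f x = f y.
Proof.
move=> ltJI; case: (boolP (injectiveb f)) => [/injectiveP inj_f|].
  by have := leq_card f inj_f; rewrite leqNgt ltJI.
by case/injectivePn=> x [y neq_xy eq_f]; exists x, y.
Qed.

(** Each form takes its values in an interval of length [2 * c * X], cut into [M] cells. Vectors
    with entries in [[0, X]] outnumber the boxes, so two of them share a box; [x] is their
    difference. *)
Lemma siegel (R : archiRealFieldType) (m d X M : nat) (a : 'M[R]_(m, d))
    (c : R) :
    (0 < X)%N -> (0 < M)%N -> (M ^ m < X.+1 ^ d)%N -> 0 < c ->
    (forall k, \sum_l `|a k l| < c) ->
  exists x : 'I_d -> int, [/\ exists l, x l != 0, forall l, `|x l| <= X%:R
    & forall k, `|\sum_l a k l * (x l)%:~R| * M%:R <= 2 * c * X%:R].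
Proof.
move=> X_gt0 M_gt0 lt_card c_gt0 lt_ac.
pose form (k : 'I_m) (y : {ffun 'I_d -> 'I_X.+1}) := \sum_l a k l * (y l)%:R.
have X0 : 0 < X%:R :> R by rewrite ltr0n.
have M0 : 0 < M%:R :> R by rewrite ltr0n.
have form_bound k y : `|form k y| < c * X%:R.
  apply: (@le_lt_trans _ _ ((\sum_l `|a k l|) * X%:R)); last by rewrite ltr_pM2r.
  rewrite mulr_suml (le_trans (ler_norm_sum _ _ _)) // ler_sum // => l _.
  by rewrite normrM ler_wpM2l // normr_nat ler_nat -ltnS.
pose pos k y := (form k y + c * X%:R) * M%:R / (2 * c * X%:R).
have pos_ge0 k y : 0 <= pos k y.
  have := form_bound k y; rewrite ltr_norml => /andP[lo _].
  rewrite /pos divr_ge0 ?mulr_ge0 // ?ltW // -?ltrBlDr ?sub0r //; exact: ltW.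
have pos_lt k y : pos k y < M%:R.
  have := form_bound k y; rewrite ltr_norml => /andP[_ hi].
  rewrite /pos ltr_pdivrMr ?mulr_gt0 // mulrC ltr_pM2l //; lra.
have cell_proof k y : (Num.truncn (pos k y) < M)%N.
  rewrite -(ltr_nat R); apply: le_lt_trans (pos_lt k y).
  by rewrite truncn_le.
pose cell y : {ffun 'I_m -> 'I_M} := [ffun k => Ordinal (cell_proof k y)].
have [|y1 [y2 [neq_y eq_cell]]] := @pigeonhole _ _ cell.
  by rewrite !card_ffun !card_ord.
exists (fun l => (y1 l)%:Z - (y2 l)%:Z); split.
- have /existsP[l neq_l] : [exists l, y1 l != y2 l].
    apply: contraNT neq_y; rewrite negb_exists => /forallP eq_y.
    by apply/eqP/ffunP=> l; apply/eqP; have := eq_y l; rewrite negbK.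
  by exists l; rewrite subr_eq0; apply: contra neq_l => /eqP[/val_inj->].
- by move=> l; have := ltn_ord (y1 l); have := ltn_ord (y2 l); lia.
move=> k.
have -> : \sum_l a k l * ((y1 l)%:Z - (y2 l)%:Z)%:~R = form k y1 - form k y2.
  rewrite /form -sumrB; apply: eq_bigr => l _.
  by rewrite rmorphB /= mulrBr.
have eq_tr : Num.truncn (pos k y1) = Num.truncn (pos k y2).
  by have /ffunP/(_ k) := eq_cell; rewrite !ffunE => -[].
have /andP[lo1 hi1] := truncn_itv (pos_ge0 k y1).
have /andP[lo2 hi2] := truncn_itv (pos_ge0 k y2).
rewrite eq_tr in lo1 hi1.
have: `|pos k y1 - pos k y2| <= 1.
  rewrite ler_norml; move: lo1 hi1 lo2 hi2; rewrite -!natr1; lra.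
have -> : pos k y1 - pos k y2
          = (form k y1 - form k y2) * M%:R / (2 * c * X%:R).
  by rewrite /pos -!mulrBl; congr (_ * _ / _); ring.
have D0 : 0 < 2 * c * X%:R by rewrite !mulr_gt0.
rewrite !normrM normfV normr_nat (gtr0_norm D0) ler_pdivrMr // mul1r.
by [].
Qed.

Lemma leq_expl k m n : (m <= n -> m ^ k <= n ^ k)%N.
Proof. by case: k => // k le_mn; rewrite leq_exp2r. Qed.

Definition indep (V : zmodType) (k : nat) (e : 'I_k -> V) : Prop :=
  forall a : 'I_k -> int, \sum_i e i *~ a i = 0 -> forall i, a i = 0.

Definition zmod_fg (V : zmodType) : Prop :=
  exists s : seq V, forall P : V -> Prop,
    P 0 -> (forall x y, P x -> P y -> P (x - y)) ->
    (forall x, x \in s -> P x) -> forall x, P x.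

Lemma closed_sum (V : zmodType) (P : V -> Prop) (I : Type) (s : seq I)
    (F : I -> V) (c : I -> int) :
    P 0 -> (forall x y, P x -> P y -> P (x - y)) -> (forall i, P (F i)) ->
  P (\sum_(i <- s) F i *~ c i).
Proof.
move=> P0 PB PF.
have PN x : P x -> P (- x) by move=> Px; rewrite -sub0r; exact: PB.
have PD x y : P x -> P y -> P (x + y).
  by move=> Px Py; rewrite -[y]opprK; apply: PB => //; apply: PN.
have PM x n : P x -> P (x *+ n).
  by move=> Px; elim: n => [|n IHn]; rewrite ?mulr0n // mulrS; apply: PD.
apply: (big_ind P) => // i _; case: (c i) => n; first exact: PM.
by rewrite NegzE mulrNz; apply/PN/PM.
Qed.

(** Powers of 2 play the part of logarithms: exponents add when absolute values are multiplied. *)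
Lemma pow2_bound (R : archiRealFieldType) (I : finType) (F : I -> R) :
  exists c, forall i, F i <= 2 ^+ c.
Proof.
exists (\sum_i Num.bound `|F i|)%N => i.
apply: le_trans (ler_norm _) _.
apply: le_trans (ltW (archi_boundP (normr_ge0 (F i)))) _.
rewrite -natrX ler_nat (leq_trans (ltnW (ltn_expl _ (ltnSn 1)))) //.
by rewrite leq_exp2l // (bigD1 i) //= leq_addr.
Qed.

Lemma prod_exprz (F : fieldType) (I : Type) (s : seq I) (P : pred I)
    (x : I -> F) (a : int) :
  \prod_(i <- s | P i) x i ^ a = (\prod_(i <- s | P i) x i) ^ a.
Proof.
rewrite [RHS](big_morph (fun y : F => y ^ a) (id1 := 1) (op1 := *%R)) //.
  by move=> u v; rewrite expfzMl.
exact: exp1rz.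
Qed.

(** * Multiplicative absolute values with a product formula *)

Section Absolute.

Variables (V : zmodType) (R : archiRealFieldType) (r : nat).
Variable absv : 'I_r.+1 -> V -> R.
Hypothesis absv_gt0 : forall j v, 0 < absv j v.
Hypothesis absvD : forall j u v, absv j (u + v) = absv j u * absv j v.
Hypothesis absv_prod : forall v, \prod_j absv j v = 1.

Lemma absv0 j : absv j 0 = 1.
Proof.
apply: (mulfI (lt0r_neq0 (absv_gt0 j 0))).
by rewrite -absvD addr0 mulr1.
Qed.

Lemma absvN j v : absv j (- v) = (absv j v)^-1.
Proof.
apply: (mulfI (lt0r_neq0 (absv_gt0 j v))).
by rewrite -absvD subrr absv0 mulfV // lt0r_neq0.
Qed.

Lemma absv_muln j v n : absv j (v *+ n) = absv j v ^+ n.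
Proof. by elim: n => [|n IHn]; rewrite ?absv0 // mulrS absvD IHn exprS. Qed.

Lemma absv_mulz j v (a : int) : absv j (v *~ a) = absv j v ^ a.
Proof.
by case: a => n; rewrite ?NegzE ?mulrNz ?absvN -?exprnN absv_muln.
Qed.

Lemma absv_sum j (I : Type) (s : seq I) (F : I -> V) :
  absv j (\sum_(i <- s) F i) = \prod_(i <- s) absv j (F i).
Proof. by apply: (big_morph (absv j)); [exact: absvD | exact: absv0]. Qed.

(* If [a] is a relation and [P] the set of places where [a] is positive, then
   the product over [P] of the absolute values of the relation is a product of
   factors [>= 1], and those indexed by [P] are [> 1]. *)
Lemma dominant_indep (e : 'I_r.+1 -> V) :
    (forall i j, j != i -> absv j (e i) < 1) ->
  indep (fun i : 'I_r => e (widen_ord (leqnSn r) i)).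
Proof.
move=> dom.
suff noP (a : 'I_r.+1 -> int) : a ord_max = 0 -> \sum_i e i *~ a i = 0 ->
    forall i, a i <= 0.
  move=> a' a'0.
  pose a (i : 'I_r.+1) : int := if insub (val i) is Some i' then a' i' else 0.
  have aw (i : 'I_r) : a (widen_ord (leqnSn r) i) = a' i.
    rewrite /a; case: insubP => [u _ /val_inj-> // |/=]; by rewrite ltn_ord.
  have amax : a ord_max = 0 by rewrite /a; case: insubP => //=; rewrite ltnn.
  have a0 : \sum_i e i *~ a i = 0.
    rewrite big_ord_recr /= amax addr0 -[RHS]a'0.
    by apply: eq_bigr => i _; rewrite aw.
  move=> i; apply/eqP; rewrite -(aw i) eq_le noP //=.
  rewrite -oppr_le0 (noP (fun i => - a i)) ?amax ?oppr0 //.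
  by under eq_bigr do rewrite mulrNz; rewrite sumrN a0 oppr0.
move=> amax a0 i0; rewrite leNgt; apply/negP => ai0.
pose rho i := \prod_(j | 0 < a j) absv j (e i).
have rho_gt0 i : 0 < rho i by apply: prodr_gt0.
have: \prod_i rho i ^ a i = 1.
  under eq_bigr => i _ do rewrite /rho -prod_exprz.
  rewrite exchange_big /= big1 // => j _.
  by under eq_bigr => i _ do rewrite -absv_mulz; rewrite -absv_sum a0 absv0.
(* For [0 < a i] the place [i] is counted in [rho i], so the places left out have absolute values
   below 1, and [ord_max] is one of them. The product formula then puts [rho i] above 1. *)
have rho_P i : 0 < a i -> 1 < rho i.
  move=> ai; have := absv_prod (e i); rewrite (bigID (fun j => 0 < a j)) /=.
  rewrite -/(rho i) (bigD1 ord_max) ?amax ?ltxx //= mulrCA => prod1.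
  have ne_max : ord_max != i by apply: contraTneq ai => <-; rewrite amax ltxx.
  have le1 : \prod_(j | ~~ (0 < a j) && (j != ord_max)) absv j (e i) <= 1.
    apply: prodr_ile1 => j /andP[aj _]; rewrite (ltW (absv_gt0 _ _)) ltW // dom //.
    by apply: contraNneq aj => ->.
  rewrite ltNge; apply: contra_eqN prod1 => rho_le1; rewrite lt_eqF //.
  apply: (le_lt_trans _ (dom i ord_max ne_max)).
  rewrite ger_pMr ?absv_gt0 //; apply: mulr_ile1 => //; first exact: ltW.
  by rewrite ltW // prodr_gt0.
have rho_N i : a i <= 0 -> rho i <= 1.
  move=> ai; apply: prodr_ile1 => j aj; rewrite (ltW (absv_gt0 _ _)) ltW // dom //.
  by apply: contraTneq aj => ->; rewrite -leNgt.
(* The sign of [a i] decides on which side of 1 [rho i] lies, so no factor is below 1. *)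
have ge1 i : 1 <= rho i ^ a i.
  case Dai: (a i) => [n|n].
    have [ai|ai] := ltP 0 (a i); first by rewrite exprn_ege1 // ltW ?rho_P.
    by move: ai; rewrite Dai; case: n {Dai} => // _; rewrite expr0z.
  rewrite -[_ ^ _]/(rho i ^- n.+1) -exprVn exprn_ege1 // invf_ge1 ?rho_gt0 // rho_N // Dai.
  by [].
rewrite (bigD1 i0) //= => prod1.
have gt1: 1 < rho i0 ^ a i0.
  have /gez0_abs <- := ltW ai0.
  by rewrite exprn_egt1 ?rho_P // -lt0n absz_gt0 gt_eqF.
have: 1 < (1 : R); last by rewrite ltxx.
rewrite -[X in _ < X]prod1; apply: lt_le_trans gt1 _; rewrite ler_peMr //.
  by rewrite ltW // exprz_gt0.
by apply: (big_ind (fun y => 1 <= y)) => // *; apply: mulr_ege1.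
Qed.

Hypothesis absv_fin : forall C : R,
  exists s : seq V, forall v, (forall j, absv j v <= C) -> v \in s.

(* There are more combinations with coefficients in [[0, M]] than pairs of a
   cell of the logarithmic box and an element of bounded size. *)
Lemma not_indep (e : 'I_r.+1 -> V) : ~ indep e.
Proof.
move=> ind_e.
have [c cP] : exists c, forall p : 'I_r.+1 * 'I_r.+1,
    absv p.1 (e p.2) <= 2 ^+ c /\ absv p.1 (- e p.2) <= 2 ^+ c.
  have [c1 c1P] := pow2_bound (fun p : 'I_r.+1 * 'I_r.+1 => absv p.1 (e p.2)).
  have [c2 c2P] := pow2_bound (fun p : 'I_r.+1 * 'I_r.+1 => absv p.1 (- e p.2)).
  exists (c1 + c2)%N => p; split.
    by apply: le_trans (c1P p) _; rewrite ler_weXn2l ?ler1n ?leq_addr.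
  by apply: le_trans (c2P p) _; rewrite ler_weXn2l ?ler1n ?leq_addl.
have [s sP] := absv_fin (2 ^+ r.+1).
(* This makes [(2 * L).+1 ^ r * (size s).+1] at most [M * M.+1 ^ r], which is less than the number
   [M.+1 ^ r.+1] of combinations. *)
pose M := ((2 * c * r.+1).+1 ^ r * (size s).+1)%N.
pose L := (c * M * r.+1)%N.
pose comb (a : {ffun 'I_r.+1 -> 'I_M.+1}) := \sum_i e i *+ a i.
have combE a : comb a = \sum_i e i *~ (a i)%:Z by [].
have aux (u : 'I_r.+1 -> V) j (a : {ffun 'I_r.+1 -> 'I_M.+1}) :
    (forall i, absv j (u i) <= 2 ^+ c) -> absv j (\sum_i u i *+ a i) <= 2 ^+ L.
  move=> uc; rewrite absv_sum.
  have -> : 2 ^+ L = \prod_(i < r.+1) 2 ^+ (c * M) :> R.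
    by rewrite prodr_const card_ord -exprM.
  apply: ler_prod => i _; rewrite ltW ?absv_gt0 //= absv_muln.
  apply: (@le_trans _ _ ((2 ^+ c) ^+ a i)).
    by rewrite lerXn2r ?nnegrE // ?ltW ?absv_gt0 // exprn_gt0.
  by rewrite -exprM ler_weXn2l ?ler1n // leq_mul2l -ltnS ltn_ord orbT.
have comb_le j a : absv j (comb a) <= 2 ^+ L.
  by apply: aux => i; have [] := cP (j, i).
have comb_ge j a : 1 <= absv j (comb a) * 2 ^+ L.
  rewrite -ler_pdivrMl ?absv_gt0 // mulr1 -absvN.
  have -> : - comb a = \sum_i (- e i) *+ a i.
    by rewrite -sumrN; apply: eq_bigr => i _; rewrite mulNrn.
  by apply: aux => i; have [] := cP (j, i).
(* The factor [2 ^+ L] brings the absolute values into [[1, 2 ^+ (2 * L)]]; [lev] is their integer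
   logarithm in base 2. *)
pose lev j a := trunc_log 2 (Num.truncn (absv j (comb a) * 2 ^+ L)).
have lev_lb j a : 2 ^+ lev j a <= absv j (comb a) * 2 ^+ L < 2 ^+ (lev j a).+1.
  have ge0 : 0 <= absv j (comb a) * 2 ^+ L by apply: le_trans (comb_ge j a).
  have /andP[lo hi] := truncn_itv ge0.
  have t_gt0 : (0 < Num.truncn (absv j (comb a) * 2 ^+ L))%N.
    by rewrite truncn_gt0 comb_ge.
  have /andP[lo' hi'] := trunc_log_bounds (ltnSn 1) t_gt0.
  apply/andP; split; [apply: le_trans lo | apply: lt_le_trans hi _].
    by rewrite -(natrX _ 2 (lev j a)) ler_nat.
  by rewrite -(natrX _ 2 (lev j a).+1) ler_nat.
have lev_ub j a : (lev j a < (2 * L).+1)%N.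
  have /andP[lo _] := lev_lb j a.
  rewrite ltnS -(@ler_eXn2l _ (2 : R)) ?ltr1n // (le_trans lo) //.
  by rewrite mul2n -addnn exprD ler_wpM2r // exprn_ge0.
(* Only the first [r] places are recorded: at the last one, the product formula bounds by [2 ^+ r]
   the absolute value of the difference of two combinations in a cell. *)
pose cell (a : {ffun 'I_r.+1 -> 'I_M.+1}) : {ffun 'I_r -> 'I_(2 * L).+1} :=
  [ffun j => Ordinal (lev_ub (widen_ord (leqnSn r) j) a)].
have cell_lt a b j : cell a = cell b ->
    absv (widen_ord (leqnSn r) j) (comb a - comb b) < 2.
  move=> /ffunP/(_ j); rewrite !ffunE => -[eq_lev].
  set j' := widen_ord _ j in eq_lev *.
  have /andP[_ hi] := lev_lb j' a; have /andP[lo _] := lev_lb j' b.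
  rewrite absvD absvN ltr_pdivrMr ?absv_gt0 //.
  rewrite -(@ltr_pM2r _ (2 ^+ L)) ?exprn_gt0 // -mulrA.
  by apply: lt_le_trans hi _; rewrite eq_lev exprS ler_pM2l.
have cell_s a b : cell a = cell b -> comb a - comb b \in s.
  move=> eq_ab; apply: sP => j.
  have two_r : 1 <= 2 ^+ r :> R by rewrite exprn_ege1 // ler1n.
  have [ltjr|] := ltnP j r.
    have -> : j = widen_ord (leqnSn r) (Ordinal ltjr) by apply: val_inj.
    by rewrite ltW // (lt_le_trans (cell_lt _ _ _ eq_ab)) // exprS ler_peMr.
  move=> lerj; have {lerj}-> : j = ord_max.
    by apply/val_inj/eqP; rewrite eqn_leq lerj -ltnS ltn_ord.
  have := absv_prod (comb b - comb a); rewrite big_ord_recr /= => prod1.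
  rewrite -opprB absvN -(mul1r _^-1) ler_pdivrMr ?absv_gt0 //.
  rewrite -[X in X <= _]prod1 ler_pM2r ?absv_gt0 // exprS.
  apply: (@le_trans _ _ (2 ^+ r)); last by rewrite ler_peMl ?ler1n // exprn_ge0.
  have -> : 2 ^+ r = \prod_(i < r) 2 :> R by rewrite prodr_const card_ord.
  apply: ler_prod => i _; rewrite ltW ?absv_gt0 //=.
  by apply/ltW/cell_lt.
(* The difference with a fixed representative of the cell lies in [s]; its index there completes the
   key, which thus determines the combination. *)
pose rep k := odflt [ffun=> ord0] [pick b | cell b == k].
have repP a : cell (rep (cell a)) = cell a.
  rewrite /rep; case: pickP => [b /eqP //|/(_ a)]; by rewrite eqxx.
pose key a := (cell a, inord (index (comb a - comb (rep (cell a))) s)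
  : 'I_(size s).+1).
have [|a [b [neq_ab]]] := @pigeonhole _ _ key.
  rewrite card_prod !card_ffun !card_ord [X in (_ < X)%N]expnS.
  apply: (@leq_ltn_trans (((2 * c * r.+1).+1 * M.+1) ^ r * (size s).+1)).
    rewrite leq_mul2r; apply/orP; right; apply: leq_expl.
    by rewrite /L; move: (M) => M1; nia.
  by rewrite expnMn mulnAC -/M ltn_mul2r expn_gt0 ltnSn.
case=> eq_cell; rewrite eq_cell => eq_idx.
have comb_eq : comb a = comb b.
  have as_ := cell_s _ _ (esym (repP a)); have bs := cell_s _ _ (esym (repP b)).
  rewrite eq_cell in as_.
  apply: (addIr (- comb (rep (cell b)))).
  rewrite -(nth_index 0 as_) -(nth_index 0 bs).
  congr (nth _ _ _); have /(congr1 val) := eq_idx.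
  by rewrite /= !inordK // ltnS index_size.
case/eqP: neq_ab; apply/ffunP => i; apply: val_inj; apply/eqP.
rewrite -eqz_nat -subr_eq0; apply/eqP.
apply: (ind_e (fun i => (a i)%:Z - (b i)%:Z)).
under eq_bigr do rewrite mulrzBr.
by rewrite sumrB -!combE comb_eq subrr.
Qed.

(** Let [e] be a maximal independent family. Every [v] has a multiple in the span of [e]; removing
    the integral parts of the rational coefficients leaves an element with bounded absolute values,
    one of finitely many. *)
Lemma absv_fg : zmod_fg V.
Proof.
have [k [[e ind_e] max_k]] : exists k, (exists e : 'I_k -> V, indep e) /\
    ~ (exists e : 'I_k.+1 -> V, indep e).
  apply: NNPP => nok.
  have all_k k : exists e : 'I_k -> V, indep e.
    elim: k => [|k IHk]; first by exists (fun=> 0) => a _ [].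
    by apply: NNPP => nk; apply: nok; exists k.
  by have [e /not_indep] := all_k r.+1.
have [c cP] := pow2_bound (fun p : 'I_r.+1 * 'I_k => absv p.1 (e p.2)).
have [s sP] := absv_fin (2 ^+ (c * k)).
exists (codom e ++ s) => P P0 PB Ps v.
have Pe i : P (e i) by apply: Ps; rewrite mem_cat codom_f.
pose ev i := if unlift ord_max i is Some i' then e i' else v.
have [a [a0 [i ai]]] : exists a : 'I_k.+1 -> int, \sum_i ev i *~ a i = 0 /\
    exists i, a i != 0.
  apply: NNPP => noa; apply: max_k; exists ev => a a0 i; apply/eqP.
  by apply/negPn/negP => ai; apply: noa; exists a; split; last by exists i.
have {}a0 : v *~ a ord_max + \sum_i e i *~ a (lift ord_max i) = 0.
  rewrite -[RHS]a0 (bigD1_ord ord_max) //= /ev unlift_none; congr (_ + _).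
  by apply: eq_bigr => l _; rewrite liftK.
have amax : a ord_max != 0.
  apply: contraNneq ai => amax.
  have /ind_e e0 : \sum_i e i *~ a (lift ord_max i) = 0.
    by rewrite -[RHS]a0 amax add0r.
  by case: (unliftP ord_max i) => [j|] ->; rewrite ?e0 ?amax.
pose m := `|a ord_max|%N; pose b i := - (a (lift ord_max i) * sgz (a ord_max)).
have vm : v *~ m = \sum_i e i *~ b i.
  rewrite /m abszEsg mulrC mulrzA.
  have -> : v *~ a ord_max = - \sum_i e i *~ a (lift ord_max i).
    by apply/eqP; rewrite -addr_eq0 a0.
  rewrite mulNrz mulrz_suml -sumrN.
  by apply: eq_bigr => j _; rewrite mulrNz mulrzA.
pose w := v - \sum_i e i *~ (b i %/ m)%Z.
have wm : w *~ m = \sum_i e i *~ (b i %% m)%Z.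
  rewrite mulrzBl vm mulrz_suml -sumrB; apply: eq_bigr => j _.
  by rewrite -mulrzA -mulrzBr [X in X - _](divz_eq _ m) addrAC subrr add0r.
suff ws : w \in s.
  have -> : v = w - (0 - \sum_i e i *~ (b i %/ m)%Z) by rewrite sub0r opprK subrK.
  have Pw : P w by apply: Ps; rewrite mem_cat ws orbT.
  by apply: (PB) => //; apply: (PB) => //; apply: closed_sum.
(* The bound is checked on [m]-th powers: the coefficients of [w *~ m] lie in [[0, m)], so each of
   its [k] terms contributes at most [2 ^+ (c * m)]. *)
apply: sP => j.
have m_gt0 : (0 < m)%N by rewrite absz_gt0.
rewrite -(@ler_pXn2r _ m) ?nnegrE ?exprn_ge0 ?(ltW (absv_gt0 _ _)) //.
rewrite -absv_muln -[w *+ m]/(w *~ m) wm absv_sum -exprM -mulnA exprM.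
have -> : (2 ^+ c) ^+ (k * m) = \prod_(i < k) (2 ^+ c) ^+ m :> R.
  by rewrite prodr_const card_ord -[RHS]exprM mulnC.
apply: ler_prod => l _; rewrite ltW ?absv_gt0 //=.
have /gez0_abs Dn : 0 <= (b l %% m)%Z by rewrite modz_ge0 // -lt0n.
have ltn : (`|(b l %% m)%Z| < m)%N by rewrite -ltz_nat Dn ltz_pmod.
rewrite -Dn; set n := `|_|%N in ltn *; rewrite -[_ *~ _]/(e l *+ n) absv_muln.
apply: (@le_trans _ _ ((2 ^+ c) ^+ n)).
  by rewrite lerXn2r ?nnegrE ?exprn_ge0 ?(ltW (absv_gt0 _ _)) ?(cP (j, l)).
by rewrite ler_weXn2l ?exprn_ege1 ?ler1n // ltnW.
Qed.

End Absolute.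

(** * Finitely generated abelian groups modulo torsion *)

Definition torsion (V : zmodType) (v : V) : Prop :=
  exists2 n, (0 < n)%N & v *+ n = 0.

Definition gens_mod_torsion (V : zmodType) (k : nat) (e : 'I_k -> V) : Prop :=
  forall v, exists c : 'I_k -> int, torsion (v - \sum_i e i *~ c i).

Section FinitelyGenerated.

Variable V : zmodType.

Lemma torsionD (u v : V) : torsion u -> torsion v -> torsion (u + v).
Proof.
move=> [m m_gt0 um] [n n_gt0 vn]; exists (m * n)%N; first by rewrite muln_gt0 m_gt0.
by rewrite mulrnDl mulrnA um mul0rn add0r mulnC mulrnA vn mul0rn.
Qed.

Lemma torsion_mulz (v : V) (a : int) : torsion v -> torsion (v *~ a).
Proof.
move=> [n n_gt0 vn]; exists n => //.
by rewrite -[_ *+ n]/(v *~ a *~ n) -mulrzA mulrC mulrzA -[v *~ n]/(v *+ n) vn mul0rz.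
Qed.

Lemma torsion_of_mulz (v : V) (a : int) : a != 0 -> v *~ a = 0 -> torsion v.
Proof.
move=> a0 va; exists `|a|%N; first by rewrite absz_gt0.
by rewrite -[_ *+ _]/(v *~ `|a|%N) abszEsg mulrC mulrzA va mul0rz.
Qed.

(* A nontrivial relation between generators is shortened by a unimodular change
   of generators until it kills a single generator, which is then dropped. *)
Lemma gens_reduce (k n : nat) (e : 'I_k -> V) (a : 'I_k -> int) :
    gens_mod_torsion e -> \sum_i e i *~ a i = 0 -> (exists i, a i != 0) ->
    (\sum_i `|a i| <= n)%N ->
  exists e' : 'I_k.-1 -> V, gens_mod_torsion e'.
Proof.
elim: n e a => [|n IHn] e a gen_e a0 [i ai] le_an.
  by move: le_an; rewrite (bigD1 i) //= leqn0 addn_eq0 absz_eq0 (negPf ai).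
have [/existsP[j /andP[ne_ji aj]]|] := boolP [exists j, (j != i) && (a j != 0)].
  wlog le_ji : i j ai aj ne_ji / (`|a j| <= `|a i|)%N.
    move=> wlog_ij; have [|/ltnW] := leqP `|a j| `|a i|; first exact: (wlog_ij i j).
    by apply: (wlog_ij j i); rewrite // eq_sym.
  (* Adding [e i *~ s] to [e j] turns the coefficient [a i] into [a i - s * a j], whose absolute
     value is smaller by that of [a j], thanks to the sign [s] and to [le_ji]. *)
  pose s := sgz (a i) * sgz (a j).
  pose e' l := e l + (if l == j then e i *~ s else 0).
  pose tr (c : 'I_k -> int) l := c l - (if l == i then s * c j else 0).
  have trE c : \sum_l e' l *~ tr c l = \sum_l e l *~ c l.
    rewrite (bigD1 i) // (bigD1 j) //= [RHS](bigD1 i) // [in RHS](bigD1 j) //=.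
    rewrite !addrA /e' /tr !eqxx eq_sym (negPf ne_ji) addr0 subr0.
    congr (_ + _); last first.
      by apply: eq_bigr => l /andP[/negPf-> /negPf->]; rewrite addr0 subr0.
    by rewrite mulrzBr mulrzDl -mulrzA addrACA addNr addr0.
  apply: (IHn e' (tr a)).
  - by move=> v; have [c cv] := gen_e v; exists (tr c); rewrite trE.
  - by rewrite trE.
  - by exists j; rewrite /tr (negPf ne_ji) subr0.
  rewrite -ltnS; apply: leq_trans le_an.
  rewrite (bigD1 i) //= [X in (_ < X)%N](bigD1 i) //= -addSn leq_add //.
    by rewrite /tr eqxx /s; move: (a i) (a j) ai aj le_ji; lia.
  by apply: leq_sum => l /negPf ne_li; rewrite /tr ne_li subr0.
rewrite negb_exists => /forallP a_i.
have tors_ei : torsion (e i).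
  apply: (torsion_of_mulz ai); rewrite -[RHS]a0 (bigD1 i) //= big1 ?addr0 // => j ne_ji.
  by have := a_i j; rewrite ne_ji negbK => /eqP->.
exists (fun j => e (lift i j)) => v; have [c cv] := gen_e v.
exists (fun j => c (lift i j)).
have -> : v - \sum_j e (lift i j) *~ c (lift i j)
          = v - (\sum_j e j *~ c j) + e i *~ c i.
  by rewrite (bigD1_ord i) //= opprD addrA addrAC subrK.
by apply: torsionD => //; apply: torsion_mulz.
Qed.

Lemma basis_mod_torsion (k : nat) (e : 'I_k -> V) : gens_mod_torsion e ->
  exists g (b : 'I_g -> V), indep b /\ gens_mod_torsion b.
Proof.
elim: k e => [|k IHk] e gen_e; first by exists 0, e; split=> // a _ [].
have [ind_e|dep_e] := classic (indep e); first by exists k.+1, e.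
have [a [a0 ai]] : exists a : 'I_k.+1 -> int, \sum_i e i *~ a i = 0 /\
    exists i, a i != 0.
  apply: NNPP => noa; apply: dep_e => a a0 i; apply/eqP.
  by apply/negPn/negP => ai; apply: noa; exists a; split; last by exists i.
by have [e' /IHk] := gens_reduce gen_e a0 ai (leqnn _).
Qed.

Lemma indep_torsion (k : nat) (b : 'I_k -> V) (c : 'I_k -> int) :
  indep b -> torsion (\sum_i b i *~ c i) -> forall i, c i = 0.
Proof.
move=> ind_b [n n_gt0 bcn] i.
have /ind_b/(_ i)/eqP : \sum_i b i *~ (c i * n) = 0.
  rewrite -[RHS]bcn -[_ *+ n]/(_ *~ n%:Z) mulrz_suml.
  by apply: eq_bigr => j _; rewrite mulrzA.
by rewrite mulf_eq0 orbC gt_eqF ?ltz_nat //= => /eqP.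
Qed.

Hypothesis fgV : zmod_fg V.

Lemma fg_basis_mod_torsion :
  exists g (b : 'I_g -> V), indep b /\ gens_mod_torsion b.
Proof.
have [s genV] := fgV.
apply: (@basis_mod_torsion (size s) (fun i => s`_i)).
suff span (v : V) : exists c : 'I_(size s) -> int, v = \sum_(i < size s) s`_i *~ c i.
  by move=> v; have [c ->] := span v; exists c; rewrite subrr; exists 1%N.
move: v; apply: genV.
- by exists (fun=> 0); rewrite big1 // => i _; rewrite mulr0z.
- move=> _ _ [c ->] [d ->]; exists (fun i => c i - d i).
  by rewrite -sumrB; apply: eq_bigr => i _; rewrite mulrzBr.
move=> x /(nthP 0)[i lt_i <-]; exists (fun j => (j == Ordinal lt_i)%:Z).
rewrite (bigD1 (Ordinal lt_i)) //= eqxx big1 ?addr0 // => j /negPf->.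
by rewrite mulr0z.
Qed.

(** A common torsion exponent for the generators modulo the span of [b] works for every element; a
    torsion element has no component along [b], by independence. *)
Lemma torsion_exponent (g : nat) (b : 'I_g -> V) : indep b ->
    gens_mod_torsion b ->
  exists2 N, (0 < N)%N & forall v : V, torsion v -> v *+ N = 0.
Proof.
move=> ind_b gen_b; have [s genV] := fgV.
have [N N_gt0 sN] : exists2 N, (0 < N)%N & forall x, x \in s ->
    exists c, (x - \sum_i b i *~ c i) *+ N = 0.
  elim: s {genV} => [|x s [N N_gt0 sN]]; first by exists 1%N.
  have [c [n n_gt0 xn]] := gen_b x; exists (N * n)%N; first by rewrite muln_gt0 N_gt0.
  move=> y; rewrite inE => /predU1P[->|/sN[d yd]]; last first.
    by exists d; rewrite mulrnA yd mul0rn.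
  by exists c; rewrite mulnC mulrnA xn mul0rn.
exists N => // v [n n_gt0 vn].
have [c vc] : exists c, (v - \sum_i b i *~ c i) *+ N = 0.
  move: v {vn}; apply: genV => //.
    by exists (fun=> 0); rewrite big1 ?subrr ?mul0rn // => i _; rewrite mulr0z.
  move=> x y [c xc] [d yd]; exists (fun i => c i - d i).
  have -> : \sum_i b i *~ (c i - d i)
            = \sum_i b i *~ c i - \sum_i b i *~ d i.
    by rewrite -sumrB; apply: eq_bigr => i _; rewrite mulrzBr.
  by rewrite opprD addrACA -opprD mulrnBl xc yd subrr.
have c0 : forall i, c i = 0.
  apply: (indep_torsion ind_b); rewrite -[X in torsion X]opprK -sub0r.
  have -> : \sum_i b i *~ c i = v - (v - \sum_i b i *~ c i).
    by rewrite opprB addrC subrK.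
  rewrite sub0r opprK; apply: torsionD; first by exists n.
  by exists N; rewrite // mulNrn vc oppr0.
move: vc; rewrite big1 ?subr0 // => i _; by rewrite c0 mulr0z.
Qed.

Variable phi : V -> algC.
Hypothesis phi0 : phi 0 = 1.
Hypothesis phiD : {morph phi : u v / u + v >-> u * v}.
Hypothesis phi_inj : injective phi.

Lemma phi_muln v n : phi (v *+ n) = phi v ^+ n.
Proof. by elim: n => [|n IHn]; rewrite ?mulr0n // mulrS phiD IHn exprS. Qed.

Lemma nat_min (P : nat -> Prop) n : P n ->
  exists m, P m /\ forall k, (k < m)%N -> ~ P k.
Proof.
elim/ltn_ind: n => n IHn Pn.
have [[k [ltkn Pk]]|nok] := classic (exists k, (k < n)%N /\ P k).
  exact: IHn ltkn Pk.
by exists n; split=> // k ltkn Pk; apply: nok; exists k.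
Qed.

(** Through [phi] the torsion becomes a group of [N]-th roots of unity, hence cyclic: it is
    generated by [w ^+ i0], with [i0] the least positive exponent for which this power is in the
    image. *)
Lemma fg_field_structure :
  exists m g (t : V) (b : 'I_g -> V),
    [/\ m.-primitive_root (phi t), indep b,
        forall v, torsion v -> exists k, v = t *+ k
      & forall v, exists k c, v = t *+ k + \sum_i b i *~ c i].
Proof.
have [g [b [ind_b gen_b]]] := fg_basis_mod_torsion.
have [N N_gt0 torsN] := torsion_exponent ind_b gen_b.
have [w prim_w] := C_prim_root_exists N_gt0.
have [|i0 [[i0_gt0 [t phi_t]] min_i0]] :=
    @nat_min (fun i => (0 < i)%N /\ exists v, phi v = w ^+ i) N.
  by split=> //; exists 0; rewrite phi0 prim_expr_order.
have tors_t v : torsion v -> exists k, v = t *+ k.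
  move=> /torsN vN.
  have /(prim_rootP prim_w)[i phi_v] : phi v ^+ N = 1.
    by rewrite -phi_muln vN phi0.
  exists (i %/ i0)%N; apply/eqP; rewrite -subr_eq0; apply/eqP.
  have phi_r : phi (v - t *+ (i %/ i0)) = w ^+ (i %% i0).
    have phi_tq : phi (t *+ (i %/ i0)) = w ^+ (i %/ i0 * i0).
      by rewrite phi_muln phi_t -exprM mulnC.
    apply: (mulIf (x := phi (t *+ (i %/ i0)))).
      by rewrite phi_tq expf_neq0 // (prim_root_eq0 prim_w) -lt0n.
    by rewrite -phiD subrK phi_tq -exprD addnC -divn_eq.
  have := min_i0 (i %% i0)%N; rewrite ltn_mod i0_gt0 => /(_ isT).
  case: posnP phi_r => [->|r_gt0] phi_r.
    by move=> _; apply: phi_inj; rewrite phi_r phi0.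
  by case; split=> //; exists (v - t *+ (i %/ i0)).
exists (N %/ gcdn i0 N)%N, g, t, b; split=> //.
  by rewrite phi_t exp_prim_root.
move=> v; have [c /tors_t[k vk]] := gen_b v.
by exists k, c; rewrite -vk subrK.
Qed.

End FinitelyGenerated.

Lemma structure_bijection (V : zmodType) (phi : V -> algC) (m g : nat) (t : V)
    (b : 'I_g -> V) :
    phi 0 = 1 -> {morph phi : u v / u + v >-> u * v} -> injective phi ->
    (1 < m)%N -> m.-primitive_root (phi t) -> indep b ->
    (forall v, exists k c, v = t *+ k + \sum_i b i *~ c i) ->
  exists2 h : 'Z_m * 'rV[int]_g -> V, bijective h & {morph h : x y / x + y}.
Proof.
move=> phi0 phiD phi_inj m_gt1 prim_t ind_b gen_tb.
have tm : t *+ m = 0.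
  by apply: phi_inj; rewrite (phi_muln phi0 phiD) prim_expr_order.
pose h (x : 'Z_m * 'rV[int]_g) := t *+ val x.1 + \sum_i b i *~ x.2 0 i.
(* The modulus of ['Z_m] is [(Zp_trunc m).+2], equal to [m] because [1 < m]. *)
have t_mod k : t *+ (k %% (Zp_trunc m).+2) = t *+ k.
  by rewrite Zp_cast // {2}(divn_eq k m) mulrnDr mulnC mulrnA tm mul0rn add0r.
have hD : {morph h : x y / x + y}.
  move=> x y; rewrite /h addrACA -mulrnDr; congr (_ + _).
    by rewrite /= t_mod.
  by rewrite -big_split; apply: eq_bigr => i _; rewrite mxE mulrzDr.
have h0 : h 0 = 0 by apply: (addrI (h 0)); rewrite -hD !addr0.
have hB x y : h (x - y) = h x - h y.
  by apply: (addIr (h y)); rewrite -hD !subrK.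
have ker_h x : h x = 0 -> x = 0.
  case: x => k c; rewrite /h /= => hx.
  have c0 : forall i, c 0 i = 0.
    apply: (indep_torsion ind_b); exists m; first exact: ltnW.
    have -> : \sum_i b i *~ c 0 i = - (t *+ k).
      by apply/eqP; rewrite -addr_eq0 addrC hx.
    by rewrite mulNrn -mulrnA mulnC mulrnA tm mul0rn oppr0.
  have tk : t *+ k = 0.
    by move: hx; rewrite big1 ?addr0 // => i _; rewrite c0 mulr0z.
  congr (_, _); last by apply/rowP => i; rewrite mxE.
  apply: val_inj => /=; apply/eqP.
  have : phi t ^+ k == 1 by rewrite -(phi_muln phi0 phiD) tk phi0.
  rewrite -(prim_order_dvd prim_t) => /dvdnP[[|q] Dk]; first by rewrite Dk.
  have := ltn_ord k; rewrite [X in (_ < X)%N](Zp_cast m_gt1) Dk; nia.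
have [h' h'K] : exists h', cancel h' h.
  have ex_h v : exists x, h x == v.
    have [k [c ->]] := gen_tb v.
    exists (inZp k, \row_i c i); apply/eqP; rewrite /h /=; congr (_ + _).
      by rewrite t_mod.
    by apply: eq_bigr => i _; rewrite mxE.
  by exists (fun v => xchoose (ex_h v)) => v; apply/eqP/(xchooseP (ex_h v)).
exists h => //; exists h' => // x; apply/eqP; rewrite -subr_eq0; apply/eqP.
by apply: ker_h; rewrite hB h'K subrr.
Qed.

(** * Norms in number fields *)

Notation qeval p x := (map_poly (ratr : rat -> algC) p).[x].
Notation zeval p x := (map_poly (intr : int -> algC) p).[x].

Lemma zeval_qeval (p : {poly int}) (x : algC) :
  zeval p x = qeval (map_poly intr p) x.
Proof.
by rewrite -map_poly_comp; congr horner; apply: eq_map_poly => a; rewrite /= rmorph_int.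
Qed.

Lemma qeval_conj (p : {poly rat}) (x : algC) : qeval p x^* = (qeval p x)^*.
Proof.
rewrite -horner_map -map_poly_comp; congr horner.
by apply: eq_map_poly => a; rewrite /= fmorph_rat.
Qed.

(** Irreducibility: if [p = h * q], then [z] is a root of [q], so that [p] divides [q], or of [h],
    whose degree is too small. *)
Lemma root_minCpoly_eq (z x : algC) : root (minCpoly z) x -> minCpoly x = minCpoly z.
Proof.
have [p [-> mon_p] dvd_p] := minCpolyP z.
have [q [-> mon_q] dvd_q] := minCpolyP x.
rewrite dvd_q => /dvdpP[h Dp].
congr map_poly; apply/eqP; rewrite -eqp_monic // /eqp.
apply/andP; split; first by rewrite Dp dvdp_mull.
have : root (map_poly ratr (h * q)) z by rewrite -Dp dvd_p.
rewrite rmorphM /= rootM => /orP[]; last by rewrite dvd_p.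
have h0 : h != 0 by apply: contraTneq mon_p => h0;
  rewrite Dp h0 mul0r monicE lead_coef0 eq_sym oner_eq0.
rewrite dvd_p => /(dvdp_leq h0); rewrite Dp size_Mmonic // leqNgt.
have: (1 < size q)%N.
  have rq : root (map_poly ratr q) x by rewrite dvd_q.
  have := root_size_gt1 _ rq; rewrite map_poly_eq0 size_map_poly; apply.
  exact: monic_neq0.
case: (size q) => [|[|k]] //= _; rewrite addnS /= addnS ltnS leq_addr.
by [].
Qed.

Lemma qeval_conjugate (z x : algC) (p : {poly rat}) :
  root (minCpoly z) x -> (qeval p x == 0) = (qeval p z == 0).
Proof.
move=> /root_minCpoly_eq; rewrite -!rootE.
have [q [-> mon_q] ->] := minCpolyP z; have [q' [-> mon_q'] ->] := minCpolyP x.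
by move=> /(map_inj_poly (fmorph_inj _) (rmorph0 _))->.
Qed.

Lemma zeval_conjugate (z x : algC) (p : {poly int}) :
  root (minCpoly z) x -> (zeval p x == 0) = (zeval p z == 0).
Proof. by rewrite !zeval_qeval; apply: qeval_conjugate. Qed.

(** The minimal polynomial of [qeval p z], composed with [p], vanishes at [z], hence at its
    conjugate [x]. *)
Lemma Aint_conjugate (z x : algC) (p : {poly rat}) :
  root (minCpoly z) x -> qeval p z \in Aint -> qeval p x \in Aint.
Proof.
move=> rx; rewrite !unfold_in => /(_ =P true) Ay.
suff -> : minCpoly (qeval p x) = minCpoly (qeval p z) by apply/eqP.
apply: root_minCpoly_eq.
have := root_minCpoly (qeval p z); have [q [-> _] _] := minCpolyP (qeval p z).
by rewrite !rootE -!horner_comp -map_comp_poly /= (qeval_conjugate _ rx).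
Qed.

(** At a common root with the derivative, the minimal polynomial would divide its own nonzero
    derivative, of smaller degree. *)
Lemma minCpoly_separable (z : algC) (rs : seq algC) :
  minCpoly z = \prod_(x <- rs) ('X - x%:P) -> uniq rs.
Proof.
move=> Dz; rewrite -separable_prod_XsubC -Dz unlock.
apply/Pdiv.ClosedField.coprimepP => x /root_minCpoly_eq <-.
have [p [Dp mon_p] dvd_p] := minCpolyP x.
rewrite Dp deriv_map -rootE dvd_p; apply/negP => /dvdp_leq.
have p_gt1 : (1 < size p)%N.
  by rewrite -(size_map_poly (ratr : {rmorphism rat -> algC})) -Dp size_minCpoly.
rewrite leqNgt (lt_size_deriv (monic_neq0 mon_p)) => dvd0; have: p^`() != 0.
  apply/eqP => /(congr1 (fun q : {poly rat} => q`_(size p).-2)); rewrite coef_deriv coef0.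
  have -> : (size p).-2.+1 = (size p).-1 by case: (size p) p_gt1 => [|[]].
  rewrite -/(lead_coef p) (monicP mon_p) => /eqP; rewrite pnatr_eq0.
  by case: (size p) p_gt1 => [|[]].
by move/dvd0.
Qed.

Lemma Aint_minCpoly (z : algC) : z \in Aint ->
  exists2 F : {poly int}, F \is monic & minCpoly z = map_poly intr F.
Proof.
move/floorpP => [F DF]; exists F => //.
have := minCpoly_monic z; rewrite DF !monicE lead_coef_map_inj //; last exact: intr_inj.
by rewrite -(inj_eq (@intr_inj algC)).
Qed.

(* The norm of [p] is the determinant of multiplication by [p] on the power
   basis; [p z] divides it because [p z] is a root of the characteristic
   polynomial, whose constant coefficient is the norm up to sign. *)
Lemma zeval_norm (z : algC) (rs : seq algC) (p : {poly int}) :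
    z \in Aint -> minCpoly z = \prod_(x <- rs) ('X - x%:P) ->
  exists (N : int) (q : {poly int}),
    \prod_(x <- rs) zeval p x = N%:~R /\ zeval p z * zeval q z = N%:~R.
Proof.
move=> Az Drs; have [F mon_F DF] := Aint_minCpoly Az.
have sz_F : size F = (size rs).+1.
  rewrite -(size_map_inj_poly (f := intr : int -> algC)) ?rmorph0 //; last exact: intr_inj.
  by rewrite -DF Drs size_prod_XsubC.
have uniq_rs := minCpoly_separable Drs.
pose d := size rs; pose m (j : nat) := Pdiv.Ring.rmodp ('X^j * p) F.
(* Column [j] is ['X^j * p] modulo [F]. The powers of a root [x] form a left eigenvector with
   eigenvalue [zeval p x], and these eigenvectors form a Vandermonde matrix, invertible since the
   conjugates are distinct. *)
pose A : 'M[int]_d := \matrix_(i, j) (m j)`_i.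
pose AC := map_mx (intr : int -> algC) A.
have powF (x : algC) (j : nat) : x \in rs ->
    \sum_(i < d) x ^+ i * ((m j)`_i)%:~R = zeval p x * x ^+ j.
  move=> rx; have Fx : zeval F x = 0.
    by apply/eqP; rewrite -DF Drs -rootE root_prod_XsubC.
  have /(congr1 (fun q => zeval q x)) := Pdiv.RingMonic.rdivp_eq mon_F ('X^j * p).
  rewrite /= rmorphD !rmorphM /= hornerD !hornerM Fx mulr0 add0r map_polyXn hornerXn.
  rewrite mulrC => ->; rewrite -/(m j).
  have le_m : (size (m j) <= d)%N.
    by rewrite -ltnS -sz_F Pdiv.Ring.ltn_rmodpN0 // monic_neq0.
  rewrite (horner_coef_wide _ (n := d)) ?(leq_trans (size_poly _ _)) //.
  by apply: eq_bigr => i _; rewrite coef_map mulrC.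
pose vec (x : algC) : 'rV[algC]_d := \row_i x ^+ i.
have vecA x : x \in rs -> vec x *m AC = zeval p x *: vec x.
  move=> rx; apply/rowP=> j; rewrite !mxE -(powF x j rx).
  by apply: eq_bigr => i _; rewrite !mxE.
pose V := (Vandermonde d (\row_(k < d) rs`_k))^T.
have VA : V *m AC = diag_mx (\row_k zeval p rs`_k) *m V.
  apply/matrixP => k j; rewrite mul_diag_mx !mxE -(powF _ j (mem_nth 0 (ltn_ord k))).
  by apply: eq_bigr => i _; rewrite !mxE.
have detV : \det V != 0.
  rewrite det_tr det_Vandermonde; apply/prodf_neq0 => i _.
  apply/prodf_neq0 => j lt_ij; rewrite !mxE subr_eq0 nth_uniq ?ltn_ord //.
  by rewrite gtn_eqF.
have detA : \prod_(x <- rs) zeval p x = (\det A)%:~R.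
  have /(congr1 determinant) := VA; rewrite !det_mulmx mulrC det_diag.
  move/(mulIf detV); rewrite -det_map_mx => ->.
  rewrite (big_nth 0) big_mkord; by apply: eq_bigr => k _; rewrite mxE.
exists (\det A); pose chi := char_poly A.
(* [chi] vanishes at [zeval p z] and has constant term [(-1) ^+ d * \det A]; moving that term to the
   other side gives this cofactor and its sign. *)
exists (((-1) ^+ d.+1)%:P * (drop_poly 1 chi \Po p)); split=> //.
have rz : z \in rs by rewrite -root_prod_XsubC -Drs root_minCpoly.
have : zeval chi (zeval p z) = 0.
  apply/eqP; rewrite /chi map_char_poly -rootE -eigenvalue_root_char.
  apply/eigenvalueP; exists (vec z); first exact: vecA.
  have d_gt0 : (0 < d)%N by rewrite /d; case: (rs) rz.
  apply/eqP => /rowP/(_ (Ordinal d_gt0)); rewrite !mxE expr0 => /eqP.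
  by rewrite oner_eq0.
rewrite -{1}(poly_take_drop 1 chi) rmorphD rmorphM /= hornerD hornerM.
rewrite map_polyXn hornerXn expr1.
have -> : take_poly 1 chi = (chi`_0)%:P.
  apply/polyP => i; rewrite coef_take_poly coefC.
  by case: i.
rewrite map_polyC hornerC /= char_poly_det => /eqP; rewrite addr_eq0 => /eqP Dn.
rewrite rmorphM /= map_polyC hornerM hornerC map_comp_poly horner_comp /=.
rewrite mulrCA [X in _ * X]mulrC -[X in _ * X]opprK -Dn.
rewrite mulrN -rmorphM -rmorphN /= mulrA -exprD.
by rewrite addSn exprS addnn -mul2n exprM sqrrN !expr1n mulr1 mulN1r opprK.
Qed.

(** One root is kept from each pair of complex conjugates: [w] lists the places of a totally complex
    field. With [r.+1] places, [r] is the unit rank. *)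
Definition half_roots (z : algC) (r : nat) (w : 'I_r.+1 -> algC) : Prop :=
  minCpoly z = \prod_j (('X - (w j)%:P) * ('X - ((w j)^*)%:P)).

Lemma half_roots_exist (z : algC) :
    (forall x, root (minCpoly z) x -> x \isn't Creal) ->
  exists r (w : 'I_r.+1 -> algC), half_roots z w.
Proof.
move=> imz; have [rs Drs] := closed_field_poly_normal (minCpoly z).
rewrite (monicP (minCpoly_monic z)) scale1r in Drs.
have uniq_rs := minCpoly_separable Drs.
have rsE x : (x \in rs) = root (minCpoly z) x by rewrite Drs root_prod_XsubC.
have conj_rs x : (x^* \in rs) = (x \in rs).
  rewrite !rsE; have [p [-> _] _] := minCpolyP z.
  by rewrite !rootE qeval_conj conjC_eq0.
pose s := [seq x <- rs | 0 < 'Im x].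
have perm_rs : perm_eq rs (s ++ map Num.conj s).
  apply: uniq_perm => //.
    rewrite cat_uniq (map_inj_uniq (inv_inj conjCK)) !filter_uniq // andbT /=.
    apply/hasPn => y /mapP[x]; rewrite mem_filter => /andP[x_gt0 _] ->.
    by rewrite mem_filter Im_conj oppr_gt0 (lt_gtF x_gt0).
  move=> x; rewrite mem_cat mem_filter.
  have -> : (x \in map Num.conj s) = (x^* \in s).
    by rewrite -{1}[x]conjCK (mem_map (inv_inj conjCK)).
  rewrite mem_filter Im_conj oppr_gt0 conj_rs -andb_orl.
  case rx : (x \in rs); rewrite ?andbF // andbT.
  have := imz x; rewrite -rsE rx => /(_ isT)/Creal_ImP/eqP.
  by rewrite real_neqr_lt ?Creal_Im ?real0 // orbC => ->.
have s_gt0 : (0 < size s)%N.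
  rewrite lt0n size_eq0; apply/eqP => s0; have := perm_size perm_rs.
  have := size_minCpoly z; rewrite Drs size_prod_XsubC s0 /=.
  by case: (size rs).
exists (size s).-1, (fun j => s`_j).
rewrite /half_roots Drs (perm_big _ perm_rs) big_cat big_map /= -big_split /=.
by rewrite (big_nth 0) big_mkord -[in LHS](prednK s_gt0).
Qed.

Section HalfRoots.

Variables (z : algC) (r : nat) (w : 'I_r.+1 -> algC).
Hypotheses (Az : z \in Aint) (Dz : half_roots z w).

Let rs := [seq w j | j <- index_enum 'I_r.+1]
  ++ [seq (w j)^* | j <- index_enum 'I_r.+1].

Lemma half_roots_prod : minCpoly z = \prod_(x <- rs) ('X - x%:P).
Proof.
by rewrite Dz /rs big_cat !big_map /= -big_split.
Qed.

Lemma size_minCpoly_half : size (minCpoly z) = (2 * r.+1).+1.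
Proof.
by rewrite half_roots_prod size_prod_XsubC size_cat !size_map /index_enum
  -enumT size_enum_ord addnn mul2n.
Qed.

Lemma half_root j : root (minCpoly z) (w j).
Proof. by rewrite half_roots_prod root_prod_XsubC mem_cat map_f ?mem_index_enum. Qed.

Lemma prod_qeval (p : {poly rat}) :
  \prod_(x <- rs) qeval p x = \prod_j `|qeval p (w j)| ^+ 2.
Proof.
rewrite /rs big_cat !big_map /= -big_split /=; apply: eq_bigr => j _.
by rewrite qeval_conj normCK.
Qed.

Lemma zeval_half_norm (p : {poly int}) :
  exists (N : nat) (q : {poly int}),
    \prod_j `|zeval p (w j)| ^+ 2 = N%:R /\ zeval p z * zeval q z = N%:R.
Proof.
have [N [q [DN Dq]]] := zeval_norm p Az half_roots_prod.
have {}DN : \prod_j `|zeval p (w j)| ^+ 2 = N%:~R.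
  rewrite -DN; under [RHS]eq_bigr do rewrite zeval_qeval.
  by rewrite prod_qeval; apply: eq_bigr => j _; rewrite zeval_qeval.
have N_ge0 : 0 <= N.
  rewrite -(ler0z algC) -DN prodr_ge0 // => j _; exact: exprn_ge0.
by exists `|N|%N, q; rewrite DN Dq -[_%:R]/((`|N|%N : int)%:~R) gez0_abs.
Qed.

(** The product over all roots is rational, since clearing denominators in [p] gives the norm of an
    integer polynomial. It is also an algebraic integer, hence a positive integer. *)
Lemma qeval_norm_ge1 (p : {poly rat}) : qeval p z \in Aint -> qeval p z != 0 ->
  1 <= \prod_j `|qeval p (w j)| ^+ 2.
Proof.
move=> Ap nz_p; rewrite -prod_qeval.
have Arat : \prod_(x <- rs) qeval p x \in Crat.
  have [p0 [a nz_a Dp]] := rat_poly_scale p.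
  have [N [_ [DN _]]] := zeval_norm p0 Az half_roots_prod.
  have -> : \prod_(x <- rs) qeval p x = ratr (a%:~R ^- size rs * N%:~R).
    rewrite rmorphM rmorph_int /= -DN fmorphV rmorphXn rmorph_int /= -exprVn.
    rewrite -(count_predT rs) -iter_mulr_1 -big_const_seq -big_split /=.
    apply: eq_bigr => x _.
    by rewrite Dp map_polyZ hornerZ fmorphV rmorph_int /= zeval_qeval.
  exact: Crat_rat.
have root_rs x : x \in rs -> root (minCpoly z) x.
  by move=> rx; rewrite half_roots_prod root_prod_XsubC.
have Aprod : \prod_(x <- rs) qeval p x \in Aint.
  rewrite big_seq rpred_prod // => x /root_rs rx; exact: Aint_conjugate rx Ap.
have /intrP[N DN] := Cint_rat_Aint Arat Aprod.
have: 0 < \prod_(x <- rs) qeval p x.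
  rewrite prod_qeval prodr_gt0 // => j _.
  by rewrite exprn_gt0 // normr_gt0 (qeval_conjugate _ (half_root j)).
by rewrite DN ltr0z ler1z.
Qed.

Lemma qeval_unit_norm (p q : {poly rat}) :
    qeval p z \in Aint -> qeval q z \in Aint -> qeval p z * qeval q z = 1 ->
  \prod_j `|qeval p (w j)| = 1.
Proof.
move=> Ap Aq pq1; have pq0 : qeval p z * qeval q z != 0 by rewrite pq1 oner_eq0.
move: pq0; rewrite mulf_eq0 negb_or => /andP[p0 q0].
have pq_w j : qeval p (w j) * qeval q (w j) = 1.
  apply/eqP; rewrite -subr_eq0.
  have := qeval_conjugate (p * q - 1) (half_root j).
  by rewrite !rmorphB !rmorphM !rmorph1 /= !hornerE pq1 subrr eqxx => ->.
have p_ge1 := qeval_norm_ge1 Ap p0; have q_ge1 := qeval_norm_ge1 Aq q0.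
have P_ge0 : 0 <= \prod_j `|qeval p (w j)| by rewrite prodr_ge0.
apply/eqP; rewrite -(@pexpr_eq1 _ _ 2) // -prodrXl eq_le p_ge1 andbT.
apply: le_trans (ler_peMr _ q_ge1) _; first exact: le_trans p_ge1.
rewrite -big_split big1 //= => j _.
by rewrite -exprMn -normrM pq_w normr1 expr1n.
Qed.

(** A nonzero algebraic integer cannot have norm below 1. This discreteness makes bounded sets of
    units finite. *)
Lemma qeval_small_eq (p q : {poly rat}) :
    qeval p z \in Aint -> qeval q z \in Aint ->
    (forall j, `|qeval p (w j) - qeval q (w j)| ^+ 2 < 1) ->
  qeval p z = qeval q z.
Proof.
move=> Ap Aq lt1; apply/eqP; rewrite -subr_eq0; apply/negPn/negP => nz.
have evB x : qeval (p - q) x = qeval p x - qeval q x.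
  by rewrite rmorphB hornerD hornerN.
have ge1 : 1 <= \prod_j `|qeval (p - q) (w j)| ^+ 2.
  by apply: qeval_norm_ge1; rewrite evB ?rpredB.
have: \prod_j `|qeval (p - q) (w j)| ^+ 2 < 1.
  under eq_bigr do rewrite evB.
  rewrite big_ord_recr /= (le_lt_trans _ (lt1 ord_max)) // ler_piMl ?exprn_ge0 //.
  by apply: prodr_ile1 => i _; rewrite exprn_ge0 //= ltW.
by move/(le_lt_trans ge1); rewrite ltxx.
Qed.

End HalfRoots.

(** * Dirichlet's unit theorem *)

Definition ReR (x : algC) : algR := in_algR (algCreal_Re x).
Definition ImR (x : algC) : algR := in_algR (algCreal_Im x).

Lemma le_algR (x y : algR) : (x <= y) = (algRval x <= algRval y).
Proof. by []. Qed.

Lemma lt_algR (x y : algR) : (x < y) = (algRval x < algRval y).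
Proof. by []. Qed.

Lemma norm_le_Re_Im (x : algC) : `|x| <= `|'Re x| + `|'Im x|.
Proof.
by rewrite {1}[x]algCrect (le_trans (ler_normD _ _)) // normrM normCi mul1r.
Qed.

(** * Units that are small at all places but one *)

Section UnitsExist.

Variables (z : algC) (r : nat) (w : 'I_r.+1 -> algC).
Hypotheses (Az : z \in Aint) (Dz : half_roots z w).

Let d := (2 * r.+1)%N.

Lemma zeval_rVpoly (x : 'rV[int]_d) (y : algC) :
  zeval (rVpoly x) y = \sum_(l < d) y ^+ l * (x 0 l)%:~R.
Proof.
rewrite (horner_coef_wide _ (n := d)).
  by apply: eq_bigr => l _; rewrite coef_map coef_rVpoly_ord mulrC.
by rewrite (leq_trans (size_poly _ _)) // size_poly.
Qed.

(** The real and imaginary parts at the places other than [i] are [2 * r] real forms in [2 * r.+1]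
    integers. In [siegel], [X = T ^ r] and [M = T ^ r.+1] satisfy [M ^ (2 * r) = X ^ (2 * r.+1)] and
    make the forms of order [1 / T]. *)
Lemma short_poly (i : 'I_r.+1) :
  exists2 c : algC, 0 < c & forall T, (0 < T)%N ->
    exists p : {poly int}, [/\ (size p <= d)%N, p != 0,
      forall j, j != i -> `|zeval p (w j)| * T%:R <= c
    & `|zeval p (w i)| <= c * (T ^ r)%:R].
Proof.
pose a : 'M[algR]_(r + r, d) := \matrix_(k, l)
  match split k with
  | inl j => ReR (w (lift i j) ^+ l)
  | inr j => ImR (w (lift i j) ^+ l)
  end.
have [c0 c0P] := pow2_bound (fun k => \sum_l `|a k l|).
pose C : algR := 2 ^+ c0 + 1.
have C_gt0 : 0 < C by rewrite ltr_wpDl ?exprn_ge0.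
(* The first term covers the real and imaginary parts at the other places, [2 * C] each; the second
   is the trivial bound at [w i]. *)
pose c := 4 * algRval C + \sum_(l < d) `|w i| ^+ l.
have sum_ge0 : 0 <= \sum_(l < d) `|w i| ^+ l.
  by rewrite sumr_ge0 // => l _; rewrite exprn_ge0.
have C4_gt0 : 0 < 4 * algRval C by rewrite mulr_gt0.
exists c => [|T T_gt0]; first by rewrite ltr_wpDr.
have Tr_gt0 n : (0 < T ^ n)%N by rewrite expn_gt0 T_gt0.
have [|k|x [[l0 xl0] x_le x_form]] :=
    @siegel _ (r + r) d (T ^ r) (T ^ r.+1) a C (Tr_gt0 _) (Tr_gt0 _) _ C_gt0 _.
- rewrite -expnM mulnC addnn -mul2n mulnAC mulnC expnM ltn_exp2r //.
- by rewrite (le_lt_trans (c0P k)) // ltrDl.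
pose v : 'rV[int]_d := \row_l x l.
have evE y : zeval (rVpoly v) y = \sum_(l < d) y ^+ l * (x l)%:~R.
  by rewrite zeval_rVpoly; apply: eq_bigr => l _; rewrite mxE.
exists (rVpoly v); split.
- exact: size_poly.
- apply: contraNneq xl0 => /(congr1 (fun p : {poly int} => p`_l0)).
  by rewrite coef_rVpoly_ord mxE coef0 => ->.
- move=> j; rewrite eq_sym => /unlift_some[j' -> _].
  have part (f : algC -> algR) (k : 'I_(r + r)) :
      (forall l : 'I_d, a k l = f (w (lift i j') ^+ l)) ->
      algRval (\sum_l a k l * (x l)%:~R)
        = \sum_(l < d) algRval (f (w (lift i j') ^+ l)) * (x l)%:~R.
    move=> ak; rewrite rmorph_sum; apply: eq_bigr => l _.
    by rewrite rmorphM rmorph_int /= ak.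
  have bound (k : 'I_(r + r)) :
     `|algRval (\sum_l a k l * (x l)%:~R)| * T%:R <= 2 * algRval C.
    have := x_form k; rewrite le_algR !rmorphM !rmorph_nat /= expnS natrM mulrA.
    by rewrite ler_pM2r // ltr0n.
  have Re_part : 'Re (zeval (rVpoly v) (w (lift i j')))
      = algRval (\sum_l a (lshift r j') l * (x l)%:~R).
    rewrite (part ReR); last by move=> l; rewrite mxE (unsplitK (inl _ j')).
    rewrite evE raddf_sum; apply: eq_bigr => l _.
    by rewrite /= ReMr ?realz.
  have Im_part : 'Im (zeval (rVpoly v) (w (lift i j')))
      = algRval (\sum_l a (rshift r j') l * (x l)%:~R).
    rewrite (part ImR); last by move=> l; rewrite mxE (unsplitK (inr _ j')).
    rewrite evE raddf_sum; apply: eq_bigr => l _.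
    by rewrite /= ImMr ?realz.
  apply: (@le_trans _ _ (4 * algRval C)); last by rewrite lerDl.
  apply: (@le_trans _ _ ((`|'Re (zeval (rVpoly v) (w (lift i j')))|
     + `|'Im (zeval (rVpoly v) (w (lift i j')))|) * T%:R)).
    by rewrite ler_wpM2r // norm_le_Re_Im.
  rewrite mulrDl Re_part Im_part (le_trans (lerD (bound _) (bound _))) //.
  by rewrite -mulrDl -natrD.
apply: (@le_trans _ _ ((\sum_(l < d) `|w i| ^+ l) * (T ^ r)%:R)); last first.
  by rewrite ler_wpM2r // lerDr ltW.
rewrite evE mulr_suml (le_trans (ler_norm_sum _ _ _)) // ler_sum // => l _.
rewrite normrM normrX ler_wpM2l ?exprn_ge0 // -intr_norm -[_%:R]/((T ^ r)%:Z%:~R).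
by rewrite ler_int; have := x_le l; rewrite natz.
Qed.

Lemma zeval_neq0 (p : {poly int}) : (size p <= d)%N -> p != 0 -> zeval p z != 0.
Proof.
move=> sz_p p0; rewrite zeval_qeval -rootE.
have [q [Dq _] ->] := minCpolyP z; apply/negP => /dvdp_leq.
rewrite map_poly_eq0_id0 ?intr_eq0 ?lead_coef_eq0 // => /(_ p0).
rewrite size_map_poly_id0 ?intr_eq0 ?lead_coef_eq0 //.
rewrite -(size_map_poly (ratr : {rmorphism rat -> algC}) q) -Dq (size_minCpoly_half Dz).
by rewrite ltnNge sz_p.
Qed.

(** Each new element comes from [short_poly], with [T] so large that it is smaller than the previous
    ones away from [i]. Its norm is at most [(c * T ^ r * (c / T) ^ r) ^ 2 = c ^ d] whatever [T] is,
    so [C] does not depend on [n]. *)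
Lemma decreasing_polys (i : 'I_r.+1) :
  exists C, forall n, exists alpha : nat -> {poly int},
    (forall k, (k < n)%N ->
      [/\ (size (alpha k) <= d)%N, zeval (alpha k) z != 0
        & \prod_j `|zeval (alpha k) (w j)| ^+ 2 <= C%:R]) /\
    (forall k l, (k < l < n)%N -> forall j, j != i ->
      `|zeval (alpha l) (w j)| < `|zeval (alpha k) (w j)|).
Proof.
have [c c_gt0 shortP] := short_poly i; have c_ge0 := ltW c_gt0.
pose C := Num.bound (c ^+ d).
have C_ge : c ^+ d <= C%:R by rewrite ltW // archi_boundP // exprn_ge0.
exists C; elim=> [|n [alpha [good dec]]]; first by exists (fun=> 0); split=> // k l /andP[].
(* [2 ^ c0] bounds these quotients, so with [T = 2 ^ c0.+1] the bound [c / T] is strictly below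
   every earlier absolute value. *)
pose F (p : 'I_n * 'I_r.+1) : algR :=
  in_algR (normr_real (c / zeval (alpha p.1) (w p.2))).
have [c0 c0P] := pow2_bound F.
have [|p [sz_p p0 small_p big_p]] := shortP (2 ^ c0.+1)%N; first by rewrite expn_gt0.
set T := (2 ^ c0.+1)%N in small_p big_p.
have T_gt0 : 0 < T%:R :> algC by rewrite ltr0n expn_gt0.
exists (fun k => if k == n then p else alpha k); split=> [k|k l /andP[lt_kl]].
  rewrite ltnS leq_eqVlt; case: eqP => [_ _|_ /= lt_kn]; last exact: good.
  split=> //; first exact: zeval_neq0.
  apply: le_trans C_ge; rewrite prodrXl /d mulnC exprM.
  rewrite ler_pXn2r ?nnegrE ?prodr_ge0 ?exprn_ge0 //.
  have prod_le : \prod_(j < r) `|zeval p (w (lift i j))| * (T ^ r)%:R <= c ^+ r.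
    have -> : (T ^ r)%:R = \prod_(j < r) T%:R :> algC.
      by rewrite prodr_const card_ord natrX.
    have -> : c ^+ r = \prod_(j < r) c by rewrite prodr_const card_ord.
    rewrite -big_split ler_prod //= => j _.
    by rewrite mulr_ge0 // small_p // eq_sym neq_lift.
  rewrite (bigD1_ord i) //= exprS.
  apply: (@le_trans _ _ (c * (T ^ r)%:R * \prod_(j < r) `|zeval p (w (lift i j))|)).
    by rewrite ler_wpM2r ?prodr_ge0.
  by rewrite -mulrA ler_wpM2l // mulrC.
rewrite ltnS leq_eqVlt; case: eqP => [eq_ln _|_ /= lt_ln] j ne_ji; last first.
  by rewrite ltn_eqF ?(ltn_trans lt_kl) // dec // lt_kl.
rewrite eq_ln in lt_kl; rewrite ltn_eqF //; have [_ nz_k _] := good k lt_kl.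
have nz_kj : 0 < `|zeval (alpha k) (w j)|.
  by rewrite normr_gt0 (zeval_conjugate _ (half_root Dz j)).
have := c0P (Ordinal lt_kl, j); rewrite le_algR rmorphXn rmorph_nat /=.
rewrite normrM normfV (gtr0_norm c_gt0) ler_pdivrMr // => c_le.
rewrite -(ltr_pM2r T_gt0) (le_lt_trans (small_p j ne_ji)) //.
rewrite (le_lt_trans c_le) // mulrC ltr_pM2l // -natrX ltr_nat.
by rewrite ltn_exp2l.
Qed.

(** Two elements of the sequence have coefficients congruent modulo the factorial of [C], a multiple
    of both norms. Each divides the other, and their quotient is below 1 away from [i] because the
    sequence decreases. *)
Lemma dominant_unit (i : 'I_r.+1) :
  exists p q : {poly int}, zeval p z * zeval q z = 1 /\
    forall j, j != i -> `|zeval p (w j)| < 1.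
Proof.
have [C decP] := decreasing_polys i.
pose M := C`!; have M_gt0 : (0 < M)%N := fact_gt0 C.
have [alpha [good dec]] := decP #|{ffun 'I_d -> 'I_M}|.+1.
have residue_proof (p : {poly int}) l : (`|(p`_l %% M)%Z| < M)%N.
  by rewrite -ltz_nat gez0_abs ?modz_ge0 ?ltz_pmod // -lt0n.
pose key (k : 'I_(#|{ffun 'I_d -> 'I_M}|.+1)) : {ffun 'I_d -> 'I_M} :=
  [ffun l : 'I_d => Ordinal (residue_proof (alpha k) l)].
(* At [z], [p * p'] is the norm [N], which divides [M]; so [p] divides [M], and hence
   [p + h * M]. *)
have quot (p q h : {poly int}) : zeval p z != 0 ->
    \prod_j `|zeval p (w j)| ^+ 2 <= C%:R -> q = p + h * (M%:Z)%:P ->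
    exists e : {poly int}, zeval e z * zeval p z = zeval q z.
  move=> nz_p le_pC ->; have [N [p' [DN Dp']]] := zeval_half_norm Az Dz p.
  have N_gt0 : (0 < N)%N.
    rewrite -(ltr0n algC) -DN prodr_gt0 // => j _.
    by rewrite exprn_gt0 // normr_gt0 (zeval_conjugate _ (half_root Dz j)).
  have /divnK DM : (N %| M)%N by rewrite dvdn_fact // N_gt0 -(ler_nat algC) -DN.
  exists (1 + h * p' * ((M %/ N)%N%:Z)%:P).
  have DMC : (M%:Z)%:~R = ((M %/ N)%N%:Z)%:~R * N%:R :> algC.
    by rewrite -!pmulrn -natrM DM.
  rewrite !rmorphD !rmorphM rmorph1 /= !map_polyC !hornerE /= DMC -Dp'; ring.
have [k [l [ne_kl eq_key]]] : exists k l, k != l /\ key k = key l.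
  by apply: pigeonhole; rewrite card_ord.
wlog lt_kl : k l ne_kl eq_key / (k < l)%N.
  move=> wlog_kl; move: (ne_kl); rewrite neq_ltn => /orP[|]; first exact: (wlog_kl k l).
  by apply: (wlog_kl l k); rewrite // eq_sym.
have [sz_k nz_k le_k] := good k (ltn_ord k).
have [sz_l nz_l le_l] := good l (ltn_ord l).
have lt_lk : (k < l < #|{ffun 'I_d -> 'I_M}|.+1)%N by rewrite lt_kl ltn_ord.
have {dec}dec := dec k l lt_lk.
have eq_mod m : ((alpha k)`_m = (alpha l)`_m %[mod M])%Z.
  have [lt_md|le_dm] := ltnP m d; last by rewrite !nth_default ?(leq_trans _ le_dm).
  have /ffunP/(_ (Ordinal lt_md)) := eq_key; rewrite !ffunE => -[] eq_abs.
  by rewrite -[LHS]gez0_abs ?eq_abs ?gez0_abs ?modz_ge0 // -lt0n.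
pose h := \poly_(m < d) (((alpha l)`_m - (alpha k)`_m) %/ M)%Z.
have Dl : alpha l = alpha k + h * (M%:Z)%:P.
  apply/polyP => m; rewrite coefD coefMC coef_poly.
  case: ltnP => [lt_md|le_dm]; last first.
    by rewrite mul0r addr0 !nth_default ?(leq_trans _ le_dm).
  rewrite divzK ?subrKC //.
  by rewrite -eqz_mod_dvd eq_mod.
have [e De] := quot _ _ _ nz_k le_k Dl.
have [e' De'] : exists e', zeval e' z * zeval (alpha l) z = zeval (alpha k) z.
  by apply: (quot _ _ (- h)); rewrite // mulNr Dl addrK.
exists e, e'; split.
  by apply: (mulIf nz_k); rewrite mulrAC mul1r De mulrC.
move=> j ne_ji.
have : zeval (e * alpha k - alpha l) (w j) == 0.
  rewrite (zeval_conjugate _ (half_root Dz j)).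
  by rewrite rmorphB rmorphM /= !hornerE De subrr.
rewrite rmorphB rmorphM /= !hornerE subr_eq0 => /eqP Dwj.
have nz_kj : 0 < `|zeval (alpha k) (w j)|.
  by rewrite normr_gt0 (zeval_conjugate _ (half_root Dz j)).
by rewrite -(ltr_pM2r nz_kj) -normrM Dwj mul1r dec.
Qed.

End UnitsExist.

Lemma finite_of_key (T : eqType) (J : finType) (key : T -> J) (P : T -> Prop) :
    (forall u v, P u -> P v -> key u = key v -> u = v) ->
  exists s : seq T, forall v, P v -> v \in s.
Proof.
move=> key_inj.
suff [s sP] : exists s : seq T, forall v, P v -> key v \in enum J -> v \in s.
  by exists s => v Pv; apply: sP; rewrite ?mem_enum.
elim: (enum J) => [|j js [s sP]]; first by exists [::].
have [[u [Pu Du]]|no_u] := classic (exists u, P u /\ key u = j).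
  exists (u :: s) => v Pv; rewrite !inE => /predU1P[Dv|/sP->]; rewrite ?orbT //.
  by rewrite (key_inj v u) ?eqxx // Du.
exists s => v Pv; rewrite inE => /predU1P[Dv|]; last exact: sP.
by case: no_u; exists v.
Qed.

(** The cells have width [1 / 2], and the shift by [K] makes the truncated numbers nonnegative. The
    bound [1 / 2] lets the squares for a real and an imaginary part add up to less than 1. *)
Lemma truncn_close (R : archiRealFieldType) (K : nat) (x y : R) :
    `|x| <= K%:R -> `|y| <= K%:R ->
    Num.truncn (2 * (x + K%:R)) = Num.truncn (2 * (y + K%:R)) ->
  (x - y) ^+ 2 < 1 / 2.
Proof.
move=> xK yK eq_t.
have ge0 (u : R) : `|u| <= K%:R -> 0 <= 2 * (u + K%:R).
  by rewrite ler_norml => /andP[lo _]; rewrite mulr_ge0 //; lra.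
have /andP[lo1 hi1] := truncn_itv (ge0 x xK).
have /andP[lo2 hi2] := truncn_itv (ge0 y yK).
rewrite eq_t in lo1 hi1; move: lo1 hi1 lo2 hi2; rewrite -![(Num.truncn _).+1%:R]natr1 => *.
have: -(1 / 2) < x - y < 1 / 2 by apply/andP; split; lra.
move: (x - y) => t /andP[lo hi].
have: 0 < (1 / 2 - t) * (1 / 2 + t) by rewrite mulr_gt0 //; lra.
have -> : (1 / 2 - t) * (1 / 2 + t) = 1 / 4 - t ^+ 2 by field.
by move=> ?; lra.
Qed.

Lemma truncn_cell (R : archiRealFieldType) (K : nat) (x : R) :
  `|x| <= K%:R -> (Num.truncn (2 * (x + K%:R)) < (4 * K).+1)%N.
Proof.
rewrite ler_norml => /andP[lo hi].
rewrite ltnS -(ler_nat R) (le_trans _ (_ : 2 * (x + K%:R) <= _)) //.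
  by rewrite truncn_le mulr_ge0 //; lra.
by rewrite natrM; lra.
Qed.

Lemma norm_Re_le (x : algC) : `|'Re x| <= `|x|.
Proof. exact: (leif_normC_Re_Creal x).1. Qed.

Lemma norm_Im_le (x : algC) : `|'Im x| <= `|x|.
Proof.
rewrite -(@ler_pXn2r _ 2) ?nnegrE // [leRHS]normC2_Re_Im real_normK ?Creal_Im //.
by rewrite lerDr real_exprn_even_ge0 ?Creal_Re.
Qed.

(** * Groups between the units of [Z[z]] and those of the integers of [Q(z)] *)

Section UnitRank.

Variables (z : algC) (r : nat) (w : 'I_r.+1 -> algC).
Hypotheses (Az : z \in Aint) (Dz : half_roots z w).
Variables (V : zmodType) (phi : V -> algC).
Hypothesis phi0 : phi 0 = 1.
Hypothesis phiD : {morph phi : u v / u + v >-> u * v}.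
Hypothesis phi_inj : injective phi.
Hypothesis phi_Aint : forall v, phi v \in Aint.
Hypothesis phi_poly : forall v, exists p : {poly rat}, qeval p z == phi v.
Hypothesis phi_units : forall p q : {poly int}, zeval p z * zeval q z = 1 ->
  exists v, phi v = zeval p z.

Let pol v := xchoose (phi_poly v).

Let polE v : qeval (pol v) z = phi v.
Proof. exact/eqP/(xchooseP (phi_poly v)). Qed.

Let phiN v : phi v * phi (- v) = 1.
Proof. by rewrite -phiD subrr. Qed.

Let phi_neq0 v : phi v != 0.
Proof.
have : phi v * phi (- v) != 0 by rewrite phiN oner_eq0.
by rewrite mulf_eq0 negb_or => /andP[].
Qed.

Let absv j v : algR := in_algR (normr_real (qeval (pol v) (w j))).

Let absv_gt0 j v : 0 < absv j v.
Proof.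
by rewrite lt_algR /= normr_gt0 (qeval_conjugate _ (half_root Dz j)) polE phi_neq0.
Qed.

Lemma conjugate_eq (p q : {poly rat}) (j : 'I_r.+1) :
  qeval p z = qeval q z -> qeval p (w j) = qeval q (w j).
Proof.
move=> eq_pq; apply/eqP; rewrite -subr_eq0.
have := qeval_conjugate (p - q) (half_root Dz j).
by rewrite rmorphB !hornerE eq_pq subrr eqxx.
Qed.

Let absvD j u v : absv j (u + v) = absv j u * absv j v.
Proof.
apply: val_inj; rewrite /= -normrM; congr `|_|.
rewrite -hornerM -rmorphM; apply: conjugate_eq.
by rewrite rmorphM hornerM !polE phiD.
Qed.

Let absv_prod v : \prod_j absv j v = 1.
Proof.
apply: val_inj; rewrite [LHS](rmorph_prod algRval) /=.
by apply: (qeval_unit_norm Az Dz (q := pol (- v))); rewrite ?polE.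
Qed.

(** Finitely many boxes cover the bounded conjugates, and by [qeval_small_eq] two integers with the
    same boxes at all places are equal. *)
Let absv_fin (C : algR) :
  exists s : seq V, forall v, (forall j, absv j v <= C) -> v \in s.
Proof.
pose K := Num.bound C.
pose cell (x : algR) := inord (Num.truncn (2 * (x + K%:R))) : 'I_(4 * K).+1.
pose key v : {ffun 'I_r.+1 -> 'I_(4 * K).+1 * 'I_(4 * K).+1} :=
  [ffun j => (cell (ReR (qeval (pol v) (w j))), cell (ImR (qeval (pol v) (w j))))].
apply: (@finite_of_key _ _ key) => u v uC vC eq_key.
have mem_le t i : (forall j, absv j t <= C) ->
    `|ReR (qeval (pol t) (w i))| <= K%:R /\ `|ImR (qeval (pol t) (w i))| <= K%:R.
  move=> tC; have le_CK : absv i t <= K%:R.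
    have C_ge0 : 0 <= C := le_trans (ltW (absv_gt0 i t)) (tC i).
    exact: le_trans (tC i) (ltW (archi_boundP C_ge0)).
  by split; apply: le_trans le_CK; [exact: norm_Re_le | exact: norm_Im_le].
apply: phi_inj; rewrite -!polE; apply: (qeval_small_eq Az Dz); rewrite ?polE //.
move=> j; have [uRe uIm] := mem_le u j uC; have [vRe vIm] := mem_le v j vC.
have /ffunP/(_ j) := eq_key; rewrite !ffunE => -[/(congr1 val) eqRe /(congr1 val) eqIm].
rewrite /= !inordK ?truncn_cell // in eqRe eqIm.
have := truncn_close uRe vRe eqRe; have := truncn_close uIm vIm eqIm.
move=> lt1 lt2; have := ltrD lt2 lt1.
have -> : 1 / 2 + 1 / 2 = 1 :> algR by field.
by rewrite normC2_Re_Im !raddfB.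
Qed.

Theorem unit_rank :
  [/\ zmod_fg V, exists e : 'I_r -> V, indep e
    & forall e : 'I_r.+1 -> V, ~ indep e].
Proof.
split.
- exact: absv_fg absv_gt0 absvD absv_prod absv_fin.
- have [e eP] : exists e : 'I_r.+1 -> V, forall i j, j != i -> absv j (e i) < 1.
    have dom i : exists v, [forall j, (j != i) ==> (absv j v < 1)].
      have [p [q [pq1 p_lt1]]] := dominant_unit Az Dz i.
      have [v Dv] := phi_units pq1; exists v; apply/forall_inP => j ne_ji.
      rewrite lt_algR /= (_ : qeval _ _ = zeval p (w j)) ?p_lt1 //.
      by rewrite zeval_qeval; apply: conjugate_eq; rewrite polE Dv zeval_qeval.
    exists (fun i => xchoose (dom i)) => i j ne_ji.
    exact: (forall_inP (xchooseP (dom i))).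
  by eexists; apply: (dominant_indep absv_gt0 absvD absv_prod eP).
exact: not_indep absv_gt0 absvD absv_prod absv_fin.
Qed.

End UnitRank.

(** * Embedding a finitely generated unit group *)

(* [ratr] is a morphism only for ordered fields, so the embedding of [rat] in a
   field of characteristic zero is redone here. *)
Section RatEmbedding.

Variables (L : fieldType) (inj_int : injective (intr : int -> L)).

Definition rat_in of injective (intr : int -> L) := fun q : rat =>
  (numq q)%:~R / (denq q)%:~R : L.

Local Notation iota := (rat_in inj_int).

Let int_neq0 (a : int) : a != 0 -> a%:~R != 0 :> L.
Proof. by move=> a0; rewrite -(rmorph0 (intr : int -> L)) (inj_eq inj_int). Qed.

Lemma rat_in_div (a b : int) : b != 0 -> iota (a%:~R / b%:~R) = a%:~R / b%:~R.
Proof.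
move=> b0; rewrite /rat_in; set q : rat := _ / _.
have q_b : q * b%:~R = a%:~R by rewrite /q divfK // intr_eq0.
apply/eqP; rewrite eqr_div ?int_neq0 ?denq_neq0 //; apply/eqP.
rewrite -!rmorphM; congr (_%:~R); apply: (@intr_inj rat).
by rewrite !rmorphM /= -q_b numqE; ring.
Qed.

Lemma rat_in_zmod_morphism : zmod_morphism iota.
Proof.
move=> x y; have dx := denq_neq0 x; have dy := denq_neq0 y.
have -> : x - y = (numq x * denq y - numq y * denq x)%:~R / (denq x * denq y)%:~R.
  rewrite -{1}[x]divq_num_den -{1}[y]divq_num_den.
  rewrite rmorphB !rmorphM /=; field; by rewrite !intr_eq0 dx dy.
rewrite rat_in_div ?mulf_neq0 // /rat_in rmorphB !rmorphM /=.
by field; rewrite !int_neq0.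
Qed.

Lemma rat_in_monoid_morphism : monoid_morphism iota.
Proof.
split; first by rewrite /rat_in divr1.
move=> x y; have dx := denq_neq0 x; have dy := denq_neq0 y.
have -> : x * y = (numq x * numq y)%:~R / (denq x * denq y)%:~R.
  rewrite -{1}[x]divq_num_den -{1}[y]divq_num_den.
  rewrite !rmorphM /=; field; by rewrite !intr_eq0 dx dy.
rewrite rat_in_div ?mulf_neq0 // /rat_in !rmorphM /=.
by field; rewrite !int_neq0.
Qed.

HB.instance Definition _ :=
  GRing.isZmodMorphism.Build rat L iota rat_in_zmod_morphism.
HB.instance Definition _ :=
  GRing.isMonoidMorphism.Build rat L iota rat_in_monoid_morphism.

(** Let [p] of least degree kill [x], and [z] be a complex root of [p]. If [q] vanishes at [z], then
    [gcdp p q] is not constant, and its cofactor in [p] is too small to kill [x]; so the gcd kills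
    [x], and [p] divides [q]. *)
Lemma minimal_transport (x : L) (p0 : {poly rat}) :
    p0 != 0 -> (map_poly iota p0).[x] = 0 ->
  exists z : algC, forall q : {poly rat},
    ((map_poly iota q).[x] == 0) = (qeval q z == 0).
Proof.
move=> nz_p0 p0x.
have [n [[p [nz_p px sz_p]] min_n]] := @nat_min (fun n => exists p : {poly rat},
  [/\ p != 0, (map_poly iota p).[x] = 0 & size p = n]) (size p0)
  (ex_intro _ p0 (And3 nz_p0 p0x erefl)).
have min_p q : q != 0 -> (map_poly iota q).[x] = 0 -> (size p <= size q)%N.
  move=> nz_q qx; rewrite leqNgt sz_p; apply/negP => /min_n; apply.
  by exists q.
have dvd_p q : ((map_poly iota q).[x] == 0) = (p %| q).
  apply/eqP/idP => [qx|/dvdpP[h ->]]; last by rewrite rmorphM hornerM px mulr0.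
  rewrite /dvdp; apply/negPn/negP => nz_r.
  have := min_p _ nz_r; rewrite leqNgt ltn_modp nz_p => r_x.
  suff /r_x : (map_poly iota (q %% p)).[x] = 0 by [].
  have := qx; rewrite {1}(divp_eq q p) rmorphD rmorphM /= hornerD hornerM px.
  by rewrite mulr0 add0r.
have p_gt1 : (1 < size p)%N.
  rewrite ltnNge; apply/negP => /size1_polyC Dp.
  have c0 : p`_0 != 0 by rewrite -polyC_eq0 -Dp.
  by move: px; rewrite Dp map_polyC hornerC => /eqP; rewrite fmorph_eq0 (negPf c0).
have /closed_rootP[z pz] : size (map_poly (ratr : {rmorphism rat -> algC}) p) != 1.
  by rewrite size_map_poly gtn_eqF.
exists z => q; rewrite dvd_p; apply/idP/idP => [/dvdpP[h ->]|qz].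
  by rewrite rmorphM hornerM (rootP pz) mulr0.
set g := gcdp p q.
have gz : root (map_poly (ratr : {rmorphism rat -> algC}) g) z.
  by rewrite gcdp_map root_gcd pz.
have nz_g : g != 0 by rewrite gcdp_eq0 (negPf nz_p).
have [h Dp] := dvdpP _ _ (dvdp_gcdl p q : g %| p).
have nz_h : h != 0 by apply: contraNneq nz_p => h0; rewrite Dp h0 mul0r.
have g_gt1 : (1 < size g)%N.
  rewrite -(size_map_poly (ratr : {rmorphism rat -> algC})).
  by apply: root_size_gt1 gz; rewrite map_poly_eq0.
have lt_hp : (size h < size p)%N.
  rewrite [X in (_ < size (polyseq X))%N]Dp size_mul //.
  rewrite -[X in (X < _)%N]addn0 -subn1 -addnBA ?(ltnW g_gt1) //.
  by rewrite ltn_add2l subn_gt0.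
have gx : (map_poly iota g).[x] == 0.
  have /eqP := px; rewrite {1}Dp rmorphM hornerM mulf_eq0 => /orP[/eqP hx|//].
  by have := min_p h nz_h hx; rewrite leqNgt lt_hp.
by apply: dvdp_trans (dvdp_gcdr p q : g %| q); rewrite -dvd_p.
Qed.

(** Each step takes the integral combination [y *+ n - x] as new primitive element. It stays in the
    subgroup [P], which will be the image of [A], and this keeps it integral. *)
Lemma primitive_element (P : L -> Prop) (s : seq L) :
    P 0 -> (forall x y, P x -> P y -> P (x - y)) ->
    (forall x, x \in s -> P x) ->
    (forall x, P x -> exists2 p : {poly rat}, p != 0 & root (map_poly iota p) x) ->
  exists2 y, P y & forall x, x \in s ->
    exists p : {poly rat}, (map_poly iota p).[y] = x.
Proof.
move=> P0 PB Ps algP.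
elim: s Ps => [|x s IHs] Ps; first by exists 0.
have [|y Py gen_y] := IHs; first by move=> u us; apply: Ps; rewrite inE us orbT.
have Px : P x by apply: Ps; rewrite inE eqxx.
have [p nz_p px] := algP x Px; have [q nz_q qy] := algP y Py.
have charQ : [pchar rat] =i pred0 by apply: pchar_num.
have [n [[px' Dx] [py' Dy]]] := pchar0_PET nz_p px nz_q qy charQ.
have PN u : P u -> P (- u) by move=> Pu; rewrite -sub0r; apply: (PB).
have PD u v : P u -> P v -> P (u + v).
  by move=> Pu Pv; rewrite -[v]opprK; apply: (PB) => //; apply: PN.
have PM u m : P u -> P (u *+ m).
  by move=> Pu; elim: m => [|m IHm]; rewrite ?mulr0n // mulrS; apply: PD.
exists (y *+ n - x); first by apply: (PB) => //; apply: PM.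
move=> u; rewrite inE => /predU1P[->|/gen_y[pu <-]]; first by exists px'.
by exists (pu \Po py'); rewrite map_comp_poly horner_comp Dy.
Qed.

End RatEmbedding.

(** * Group isomorphisms and the unit group in additive notation *)

Lemma isomorphic_sym (G H : groupType) : isomorphic G H -> isomorphic H G.
Proof.
move=> [f [g fK gK]].
have gM : {morph g : x y / (x * y)%g}.
  by move=> x y; apply: (can_inj fK); rewrite gmulfM !gK.
pose g_mul := isMultiplicative.Build H G g gM.
pose gf : {multiplicative H -> G} := HB.pack g g_mul.
by exists gf; exists f.
Qed.

Lemma isomorphic_trans (G H K : groupType) :
  isomorphic G H -> isomorphic H K -> isomorphic G K.
Proof.
move=> [f bij_f] [g bij_g].
have gfM : {morph g \o f : x y / (x * y)%g} by move=> x y; rewrite /= !gmulfM.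
pose gf_mul := isMultiplicative.Build G K (g \o f) gfM.
pose gf : {multiplicative G -> K} := HB.pack (g \o f) gf_mul.
by exists gf; apply: bij_comp.
Qed.

Lemma isomorphic_commutative (G H : groupType) :
  isomorphic G H -> commutative_group G -> commutative_group H.
Proof.
move=> [f [g fK gK]] cG x y; rewrite /commute.
by rewrite -[x]gK -[y]gK -!gmulfM cG.
Qed.

Lemma isomorphic_fg (G H : groupType) :
  isomorphic G H -> finitely_generated G -> finitely_generated H.
Proof.
move=> [f [g fK gK]] [s genG]; exists (map f s) => P [P1 PM PV] Ps x.
have f1 : f 1%g = 1%g by apply: (mulgI (f 1%g)); rewrite -gmulfM !mulg1.
have fV y : f y^-1%g = (f y)^-1%g.
  by apply: (mulgI (f y)); rewrite -gmulfM !mulgV.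
rewrite -[x]gK; move: (g x); apply: genG => [|y ys]; last by apply: Ps; apply: map_f.
split=> [|y1 y2|y] /=; first by rewrite f1.
  by rewrite gmulfM; apply: PM.
by rewrite fV; apply: PV.
Qed.

(** A second name lets the unit group carry an additive structure beside the multiplicative one. *)
Definition add_unit (A : idomainType) : Type := unit_group A.

Section AddUnit.

Variable A : idomainType.

HB.instance Definition _ := Choice.on (add_unit A).

Lemma ug_mulC : commutative (@ug_mul A).
Proof. by move=> u v; apply: val_inj; rewrite /= mulrC. Qed.

HB.instance Definition _ := GRing.isZmodule.Build (add_unit A)
  (@ug_mulA A) ug_mulC (@ug_mul1 A) (@ug_mulV A).

Definition auval (u : add_unit A) : A := ugval u.

Lemma auval_inj : injective auval.
Proof. exact: val_inj. Qed.

Lemma auval0 : auval 0 = 1.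
Proof. by []. Qed.

Lemma auvalD : {morph auval : u v / u + v >-> u * v}.
Proof. by []. Qed.

Lemma fg_add_unit : finitely_generated (unit_group A) <-> zmod_fg (add_unit A).
Proof.
split=> [] [s gen_s]; exists s => P.
  move=> P0 PB Ps; apply: gen_s => //.
  have PN (x : add_unit A) : P x -> P (- x).
    by move=> Px; rewrite -sub0r; apply: (PB).
  split=> // x y Px Py.
  suff : P ((x : add_unit A) - - (y : add_unit A)) by rewrite opprK.
  by apply: (PB) => //; apply: PN.
move=> [P1 PM PV] Ps; apply: gen_s => // x y Px Py.
by apply: (PM) => //; apply: PV.
Qed.

Lemma add_unit_isomorphic (n g : nat)
    (h : 'Z_(2 * n) * 'rV[int]_g -> add_unit A) :
  bijective h -> {morph h : x y / x + y} ->
  isomorphic (unit_group A) (C2n_Zg n g).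
Proof.
move=> bij_h hD; apply: isomorphic_sym.
pose h' : C2n_Zg n g -> unit_group A := h.
have hM : {morph h' : x y / (x * y)%g} := hD.
pose h_mul := isMultiplicative.Build (C2n_Zg n g) (unit_group A) h' hM.
pose hf : {multiplicative C2n_Zg n g -> unit_group A} := HB.pack h' h_mul.
by exists hf.
Qed.

End AddUnit.

Lemma indep_sub (V : zmodType) (k l : nat) (b : 'I_l -> V) (le_kl : (k <= l)%N) :
  indep b -> indep (fun i : 'I_k => b (widen_ord le_kl i)).
Proof.
move=> ind_b a a0 i.
pose c (j : 'I_l) : int := if insub (val j) is Some j' then a j' else 0.
have cw (i' : 'I_k) : c (widen_ord le_kl i') = a i'.
  by rewrite /c; case: insubP => [u _ /val_inj-> // |/=]; rewrite ltn_ord.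
rewrite -cw; apply: ind_b; rewrite -[RHS]a0.
rewrite (bigID (fun j : 'I_l => (j < k)%N)) /= [X in _ + X]big1 ?addr0.
  rewrite (big_ord_narrow le_kl); by apply: eq_bigr => j _; rewrite cw.
by move=> j; rewrite /c; case: insubP => [u ->|]; rewrite ?mulr0z.
Qed.

(* Integer row vectors of small entries outnumber their images. *)
Lemma indep_le (V : zmodType) (m g k : nat) (b : 'I_g -> V) (e : 'I_k -> V) :
    (0 < m)%N -> (forall v, exists c : 'I_g -> int, v *+ m = \sum_i b i *~ c i) ->
  indep e -> (k <= g)%N.
Proof.
move=> m_gt0 span ind_e; rewrite leqNgt; apply/negP => lt_gk.
pose cf i : 'I_g -> int := sval (constructive_indefinite_description _ (span (e i))).
have cfE i : e i *+ m = \sum_j b j *~ cf i j.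
  by rewrite /cf; case: constructive_indefinite_description.
pose a : 'M[rat]_(g, k) := \matrix_(j, i) (cf i j)%:~R.
have [c0 c0P] := pow2_bound (fun j => \sum_i `|a j i|).
pose c := (2 ^ c0.+1)%N.
(* This gives [(2 * c * X).+1 ^ g < X.+1 ^ g.+1]. With [(2 * c * X).+1] cells, [siegel] makes the
   integral forms smaller than 1 in absolute value, hence zero. *)
pose X := ((2 * c).+1 ^ g)%N.
have X_gt0 : (0 < X)%N by rewrite expn_gt0.
have [|||j|x [[i0 xi0] _ x_form]] := @siegel rat g k X (2 * c * X).+1 a c%:R X_gt0 _ _ _ _.
- by [].
- apply: (@leq_ltn_trans (X ^ g.+1)); last first.
    apply: (@leq_trans (X.+1 ^ g.+1)); first by rewrite ltn_exp2r.
    by rewrite leq_exp2l.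
  have -> : (X ^ g.+1 = ((2 * c).+1 * X) ^ g)%N by rewrite expnS expnMn.
  by apply: leq_expl; rewrite mulSn -add1n leq_add2r.
- by rewrite ltr0n expn_gt0.
- by rewrite (le_lt_trans (c0P j)) // natrX ltr_eXn2l // ltr1n.
have x0 j : \sum_i cf i j * x i = 0.
  apply/eqP/negPn/negP => nz_s; have := x_form j.
  have -> : \sum_l a j l * (x l)%:~R = (\sum_i cf i j * x i)%:~R.
    by rewrite rmorph_sum; apply: eq_bigr => l _; rewrite mxE rmorphM.
  have s_ge1 : 1 <= `|(\sum_i cf i j * x i)%:~R| :> rat.
    by rewrite -intr_norm ler1z -gtz0_ge1 normr_gt0.
  move/(le_trans (ler_wpM2r (ler0n _ _) s_ge1)).
  by rewrite mul1r -!natrM ler_nat ltnn.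
move: xi0; rewrite (_ : x i0 = 0) ?eqxx //.
have m0 : m%:Z != 0 by rewrite -lt0n.
apply: (mulfI m0); rewrite mulr0; apply: (ind_e (fun i => m%:Z * x i) _ i0).
under eq_bigr => i _ do rewrite mulrzA -[e i *~ m]/(e i *+ m) cfE mulrz_suml.
rewrite exchange_big big1 //= => j _.
under eq_bigr => i _ do rewrite -mulrzA.
by rewrite -mulrz_sumr x0 mulr0z.
Qed.

(** * Degrees of algebraic numbers *)

Lemma fmorph_qeval (Qn : fieldExtType rat) (QnC : {rmorphism Qn -> algC})
    (q : {poly rat}) (x : Qn) :
  QnC (map_poly (in_alg Qn) q).[x] = qeval q (QnC x).
Proof.
rewrite -horner_map -map_poly_comp; congr horner; apply: eq_map_poly => a /=.
by rewrite alg_num_field fmorph_rat.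
Qed.

Lemma size_minCpoly_minPoly (Qs : fieldExtType rat)
    (QsC : {rmorphism Qs -> algC}) (x : Qs) :
  (size (minCpoly (QsC x))).-1 = \dim <<1; x>>%VS.
Proof.
have QsC_map (p : {poly rat}) :
    map_poly QsC (map_poly (in_alg Qs) p) = map_poly ratr p.
  rewrite -map_poly_comp; apply: eq_map_poly => a /=.
  by rewrite alg_num_field fmorph_rat.
rewrite dim_Fadjoin dimv1 muln1 -[adjoin_degree _ _]/(adjoin_degree _ _).+1.-1 -size_minPoly.
congr _.-1; have [p [Dp mon_p] dvd_p] := minCpolyP (QsC x).
rewrite Dp size_map_poly.
have /polyOver1P[q Dq] := minPolyOver 1 x.
have nz_q : q != 0.
  apply: contraTneq (monic_minPoly 1 x) => q0.
  by rewrite Dq q0 rmorph0 monicE lead_coef0 eq_sym oner_eq0.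
apply/eqP; rewrite eqn_leq; apply/andP; split.
  rewrite Dq size_map_poly dvdp_leq // -dvd_p -QsC_map fmorph_root -Dq.
  exact: root_minPoly.
rewrite -(size_map_poly (in_alg Qs) p) dvdp_leq //.
  by rewrite map_poly_eq0 monic_neq0.
apply: minPoly_dvdp; first exact: alg_polyOver.
by rewrite -(fmorph_root QsC) QsC_map dvd_p.
Qed.

(** The tower law applies: the cyclotomic field lies in the field generated by [z]. *)
Lemma totient_dvd_degree (z : algC) (p : {poly rat}) (m : nat) :
  m.-primitive_root (qeval p z) -> (totient m %| (size (minCpoly z)).-1)%N.
Proof.
move=> prim_p.
have [Qs [QsC [[|z1 [|]] // [Dz] gen_z1]]] := num_field_exists [:: z].
rewrite adjoin_seq1 in gen_z1.
pose x1 := (map_poly (in_alg Qs) p).[z1].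
have Dx1 : QsC x1 = qeval p z by rewrite fmorph_qeval Dz.
rewrite -Dz size_minCpoly_minPoly gen_z1.
have -> : totient m = \dim <<1; x1>>%VS.
  by rewrite -(size_minCpoly_minPoly QsC) Dx1 (minCpoly_cyclotomic prim_p) size_cyclotomic.
exact: (field_dimS (subvf _)).
Qed.

Section UnitEmbedding.

Variable A : idomainType.
Hypotheses (injA : injective (intr : int -> A))
  (intA : integralRange (intr : int -> A)).

Variables (L : fieldType) (toL : {rmorphism A -> L}).
Hypothesis toL_inj : injective toL.

Let injL : injective (intr : int -> L).
Proof. by move=> a b; rewrite -!(rmorph_int toL) => /toL_inj/injA. Qed.

Let iota : {rmorphism rat -> L} := rat_in injL.

Let iota_int (p : {poly int}) (x : A) :
  (map_poly iota (map_poly intr p)).[toL x] = toL (map_poly intr p).[x].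
Proof.
rewrite -horner_map -!map_poly_comp; congr horner; apply: eq_map_poly => a /=.
by rewrite !rmorph_int.
Qed.

Let iota_algebraic (x : A) :
  exists2 p : {poly int}, p \is monic & (map_poly iota (map_poly intr p)).[toL x] = 0.
Proof.
have [p mon_p px] := intA x; exists p => //.
by rewrite iota_int (rootP px) rmorph0.
Qed.

(** By the primitive element theorem, all units are rational polynomials in the image [y] of one
    element [a] of [A]; sending [y] to a complex number [z] with the same annihilating polynomials
    embeds them. Units of [Z[z]] come from units of [A] because [a] is in [A]. *)
Lemma unit_embedding : zmod_fg (add_unit A) ->
  exists (z : algC) (phi : add_unit A -> algC),
    [/\ z \in Aint, phi 0 = 1, {morph phi : u v / u + v >-> u * v}
      & injective phi] /\
    [/\ forall v, phi v \in Aint,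
        forall v, exists p : {poly rat}, qeval p z == phi v
      & forall p q : {poly int}, zeval p z * zeval q z = 1 ->
          exists v, phi v = zeval p z].
Proof.
move=> [s gen_s].
(* Inverses are included, so that polynomials in [y] reach each unit and its inverse without
   division. *)
pose t := [seq toL (auval u) | u <- s ++ [seq - u | u <- s]].
have [|||x [a ->]|y [a Dy] gen_y] :=
    @primitive_element L injL (fun y => exists a, y = toL a) t.
- by exists 0; rewrite rmorph0.
- by move=> _ _ [a ->] [b ->]; exists (a - b); rewrite rmorphB.
- by move=> x /mapP[u _ ->]; exists (auval u).
- have [p mon_p px] := iota_algebraic a; exists (map_poly intr p).
    by rewrite map_poly_eq0_id0 ?intr_eq0 ?lead_coef_eq0 monic_neq0.
  exact/eqP.
have pol_ex (u : add_unit A) :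
    exists p : {poly rat}, (map_poly iota p).[y] == toL (auval u).
  suff [] : (exists p : {poly rat}, (map_poly iota p).[y] = toL (auval u)) /\
      (exists p : {poly rat}, (map_poly iota p).[y] = toL (auval (- u))).
    by move=> [p Dp] _; exists p; apply/eqP.
  move: u; apply: gen_s.
  - by split; exists 1; rewrite rmorph1 hornerC ?oppr0 auval0 rmorph1.
  - move=> u v [[p Dp] [p' Dp']] [[q Dq] [q' Dq']]; split.
      by exists (p * q'); rewrite rmorphM hornerM Dp Dq' auvalD rmorphM.
    exists (p' * q); rewrite rmorphM hornerM Dp' Dq opprB addrC auvalD rmorphM.
    by [].
  by move=> u us; split; apply: gen_y; apply: map_f; rewrite mem_cat ?us // map_f ?orbT.
pose pol u := xchoose (pol_ex u).
have polE u : (map_poly iota (pol u)).[y] = toL (auval u).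
  exact/eqP/(xchooseP (pol_ex u)).
have [p0 mon_p0 p0a] := iota_algebraic a; rewrite -Dy in p0a.
have nz_p0 : map_poly intr p0 != 0 :> {poly rat}.
  by rewrite map_poly_eq0_id0 ?intr_eq0 ?lead_coef_eq0 monic_neq0.
have [z zE] := minimal_transport nz_p0 p0a.
have eqE p q : ((map_poly iota p).[y] == (map_poly iota q).[y])
             = (qeval p z == qeval q z).
  by rewrite -subr_eq0 -[RHS]subr_eq0 -!hornerN -!hornerD -!rmorphB zE.
have Aint_root (p : {poly int}) (x : algC) : p \is monic -> zeval p x = 0 -> x \in Aint.
  move=> mon_p px; apply: (@root_monic_Aint (map_poly intr p)).
  - exact/rootP.
  - by rewrite monic_map.
  - by apply/polyOverP => i; rewrite coef_map rpred_int.
exists z, (fun u => qeval (pol u) z); do !split.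
- apply: (Aint_root p0); rewrite // zeval_qeval; apply/eqP.
  by rewrite -zE p0a.
- apply/eqP; have := eqE (pol 0) 1; rewrite polE auval0 !rmorph1 !hornerC eqxx.
  by move=> <-.
- move=> u v; apply/eqP; have := eqE (pol (u + v)) (pol u * pol v).
  by rewrite !rmorphM !hornerM !polE auvalD rmorphM eqxx => <-.
- move=> u v /eqP; rewrite -eqE !polE => /eqP/toL_inj; exact: auval_inj.
- move=> u; have [p mon_p pu] := intA (auval u).
  apply: (Aint_root p) => //; apply/eqP; rewrite zeval_qeval -horner_comp.
  rewrite -map_comp_poly -zE map_comp_poly horner_comp polE iota_int.
  by rewrite (rootP pu) rmorph0.
- by move=> u; exists (pol u).
move=> p q pq1; have: (map_poly intr p).[a] * (map_poly intr q).[a] = 1 :> A.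
  apply: toL_inj; apply/eqP.
  rewrite rmorph1 rmorphM /= -!iota_int -!Dy -hornerM -!rmorphM.
  have := eqE (map_poly intr (p * q)) 1; rewrite !rmorph1 !hornerC => ->.
  by rewrite -zeval_qeval rmorphM hornerM pq1.
move=> pq1A; have Up : (map_poly intr p).[a] \is a GRing.unit.
  by apply/unitrP; exists (map_poly intr q).[a]; rewrite mulrC pq1A.
exists (UnitGroup Up : add_unit A); apply/eqP.
by rewrite zeval_qeval -eqE polE Dy iota_int.
Qed.

End UnitEmbedding.

(** At a real conjugate the root of unity would be real, hence of square 1. Conjugating back, its
    square would be 1 at [z], against [2 < m]. *)
Lemma nonreal_conjugates (z : algC) (p : {poly rat}) (m : nat) :
    m.-primitive_root (qeval p z) -> (2 < m)%N ->
  forall x, root (minCpoly z) x -> x \isn't Creal.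
Proof.
move=> prim_p m_gt2 x rx; apply/negP => Rx.
have pm1 : qeval p x ^+ m = 1.
  apply/eqP; rewrite -subr_eq0; have := qeval_conjugate (p ^+ m - 1) rx.
  rewrite !rmorphB !rmorphXn !rmorph1 /= !hornerE => ->.
  by rewrite (prim_expr_order prim_p) subrr.
have Rp : qeval p x \is Creal.
  by apply/CrealP; rewrite -qeval_conj (CrealP Rx).
have norm1 : `|qeval p x| = 1.
  by apply/eqP; rewrite -(@pexpr_eq1 _ _ m) ?(prim_order_gt0 prim_p) // -normrX pm1 normr1.
have p2 : qeval p x ^+ 2 = 1 by rewrite -(real_normK Rp) norm1 expr1n.
have : qeval p z ^+ 2 == 1.
  rewrite -subr_eq0; have := qeval_conjugate (p ^+ 2 - 1) rx.
  rewrite !rmorphB !rmorphXn !rmorph1 /= !hornerE p2 subrr eqxx => /esym/eqP H.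
  by rewrite H.
rewrite -(prim_order_dvd prim_p) => /(dvdn_leq (isT : 0 < 2)%N).
by rewrite leqNgt m_gt2.
Qed.

(** Multiplication by [m] maps the group into the span of [b], so [r <= g] by [indep_le]; if
    [r < g], then [r.+1] members of [b] would be independent. *)
Lemma rank_unique (V : zmodType) (m g r : nat) (t : V) (b : 'I_g -> V) :
    (0 < m)%N -> t *+ m = 0 -> indep b ->
    (forall v, exists k c, v = t *+ k + \sum_i b i *~ c i) ->
    (exists e : 'I_r -> V, indep e) -> (forall e : 'I_r.+1 -> V, ~ indep e) ->
  g = r.
Proof.
move=> m_gt0 tm ind_b gen [e ind_e] max_r; apply/eqP; rewrite eqn_leq.
apply/andP; split; last first.
  apply: (@indep_le _ m _ _ b e m_gt0) => // v; have [k [c ->]] := gen v.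
  exists (fun i => c i * m); rewrite mulrnDl -mulrnA mulnC mulrnA tm mul0rn add0r.
  rewrite -[_ *+ m]/(_ *~ m%:Z) mulrz_suml.
  by apply: eq_bigr => i _; rewrite mulrzA.
rewrite leqNgt; apply/negP => lt_rg.
exact: max_r (indep_sub (le_kl := lt_rg) ind_b).
Qed.

Lemma units_forward (A : idomainType) :
    integral_over_Z A -> finitely_generated (unit_group A) ->
  exists n g : nat,
    [/\ (1 <= n)%N, (totient (2 * n) %| 2 * (g + 1))%N
      & isomorphic (unit_group A) (C2n_Zg n g)].
Proof.
move=> [injA intA] /fg_add_unit fgA.
have tofrac_inj : injective (@tofrac A).
  by move=> x y /eqP; rewrite tofrac_eq => /eqP.
have [z [phi [[Az phi0 phiD phi_inj] [phi_Aint phi_poly phi_units]]]] :=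
  unit_embedding injA intA tofrac_inj fgA.
have [m [g [t [b [prim_t ind_b _ gen]]]]] := fg_field_structure fgA phi0 phiD phi_inj.
have m_gt0 := prim_order_gt0 prim_t.
have tm : t *+ m = 0.
  by apply: phi_inj; rewrite (phi_muln phi0 phiD) prim_expr_order.
(* [-1] differs from 1 since the integers embed in [A]. Being torsion, it is a power of [t], whose
   order [m] must then be even. *)
have even_m : ~~ odd m.
  have U1 : (-1 : A) \is a GRing.unit by rewrite unitrN1.
  pose u : add_unit A := UnitGroup U1.
  have u2 : u + u = 0 by apply: auval_inj; rewrite auvalD /= mulrNN mulr1.
  have u_neq0 : u != 0.
    apply/eqP => /(congr1 (@auval A)) /= N1; have := injA (-1) 1.
    by rewrite rmorphN1 rmorph1 N1 => /(_ erefl).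
  have phi_u : phi u = -1.
    have: phi u ^+ 2 == 1 by rewrite expr2 -phiD u2 phi0.
    rewrite sqrf_eq1 => /orP[/eqP phi_u1|/eqP//].
    by case/eqP: u_neq0; apply: phi_inj; rewrite phi0.
  have [k [c Du]] := gen u.
  have c0 : forall i, c i = 0.
    apply: (indep_torsion ind_b).
    have -> : \sum_i b i *~ c i = u - t *+ k by rewrite Du addrC addKr.
    apply: torsionD; first by exists 2; rewrite // mulr2n.
    by exists m; rewrite // mulNrn -mulrnA mulnC mulrnA tm mul0rn oppr0.
  have {}Du : u = t *+ k by rewrite Du big1 ?addr0 // => i _; rewrite c0 mulr0z.
  apply/negP => odd_m; have: phi u ^+ m = 1.
    by rewrite -(phi_muln phi0 phiD) Du -mulrnA mulnC mulrnA tm mul0rn.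
  rewrite phi_u -signr_odd odd_m expr1 => /eqP.
  by rewrite eq_sym -addr_eq0 -mulr2n pnatr_eq0.
pose n := m./2.
have Dm : (2 * n)%N = m by rewrite mul2n -[RHS]odd_double_half (negPf even_m).
have m_gt1 : (1 < m)%N by case: (m) m_gt0 even_m => [|[]].
have [h bij_h hD] := structure_bijection phi0 phiD phi_inj m_gt1 prim_t ind_b gen.
exists n, g; split.
- by rewrite -(ltn_pmul2l (_ : 0 < 2)%N) // Dm muln0.
(* For [m = 2] the totient is 1. For larger [m] the field is totally complex of degree [2 * r.+1],
   and [r = g]. *)
- rewrite Dm; have [m_gt2|] := ltnP 2 m; last first.
    by move=> m_le2; have -> : m = 2 by apply/eqP; rewrite eqn_leq m_le2.
  have [p /eqP Dp] := phi_poly t; rewrite -Dp in prim_t.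
  have [r [w Dz]] := half_roots_exist (nonreal_conjugates prim_t m_gt2).
  have [_ ind_r max_r] := unit_rank Az Dz phi0 phiD phi_inj phi_Aint phi_poly phi_units.
  have -> := rank_unique m_gt0 tm ind_b gen ind_r max_r.
  have := totient_dvd_degree prim_t; rewrite (size_minCpoly_half Dz).
  by rewrite addn1.
move: h bij_h hD; rewrite -Dm => h bij_h hD; exact: add_unit_isomorphic bij_h hD.
Qed.

(** * A ring with prescribed units *)

Lemma totient_mul_prime_dvd (p x : nat) : prime p -> (0 < x)%N -> (p %| x)%N ->
  totient (x * p) = (p * totient x)%N.
Proof.
move=> p_pr x_gt0 p_x; pose e := logn p x.
have e_gt0 : (0 < e)%N by rewrite logn_gt0 mem_primes p_pr x_gt0.
have [y co_py Dx] := pfactor_coprime p_pr x_gt0; rewrite -/e in Dx.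
rewrite Dx -mulnA -expnSr !totient_coprime ?coprimeXr 1?coprime_sym //.
rewrite !totient_pfactor //; case: (e) e_gt0 => // k _ /=.
by rewrite expnS; nia.
Qed.

Lemma totient_mul_prime_ndvd (p x : nat) : prime p -> ~~ (p %| x)%N ->
  totient (x * p) = (p.-1 * totient x)%N.
Proof.
move=> p_pr p_x; have co_xp : coprime x p by rewrite coprime_sym prime_coprime.
by rewrite totient_coprime // (totient_prime p_pr) mulnC.
Qed.

(** Prime factors [p] of [k] are moved to [x] one at a time; each multiplies the totient by [p] or
    [p.-1]. *)
Lemma totient_dvd_mul (k x : nat) : (0 < k)%N -> (0 < x)%N ->
  (totient x %| totient (x * k))%N.
Proof.
elim/ltn_ind: k x => k IHk x k_gt0 x_gt0.
have [k_le1|k_gt1] := leqP k 1.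
  by have -> : k = 1 by [apply/eqP; rewrite eqn_leq k_le1]; rewrite muln1.
have [p_pr p_k] := (pdiv_prime k_gt1, pdiv_dvd k).
set p := pdiv k in p_pr p_k; have p_gt0 := prime_gt0 p_pr.
have Dk := divnK p_k; have kp_gt0 : (0 < k %/ p)%N by rewrite divn_gt0 // dvdn_leq.
rewrite -Dk [(_ * p)%N]mulnC mulnA.
apply: dvdn_trans (IHk _ _ (x * p)%N _ _); rewrite ?muln_gt0 ?x_gt0 ?ltn_Pdiv ?prime_gt1 //.
have [p_x|p_x] := boolP (p %| x)%N.
  by rewrite totient_mul_prime_dvd // dvdn_mull.
by rewrite totient_mul_prime_ndvd // dvdn_mull.
Qed.

Lemma totient_mul_dvd (k x : nat) : (0 < x)%N -> (k %| x)%N ->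
  totient (x * k) = (k * totient x)%N.
Proof.
elim/ltn_ind: k x => k IHk x x_gt0 k_x; have k_gt0 := dvdn_gt0 x_gt0 k_x.
have [k_le1|k_gt1] := leqP k 1.
  by have -> : k = 1 by [apply/eqP; rewrite eqn_leq k_le1]; rewrite muln1 mul1n.
have [p_pr p_k] := (pdiv_prime k_gt1, pdiv_dvd k).
set p := pdiv k in p_pr p_k; have p_gt0 := prime_gt0 p_pr.
have Dk := divnK p_k; have kp_gt0 : (0 < k %/ p)%N by rewrite divn_gt0 // dvdn_leq.
rewrite -{1}Dk [(_ * p)%N]mulnC mulnA.
rewrite IHk ?muln_gt0 ?x_gt0 ?ltn_Pdiv ?prime_gt1 //; last first.
  by rewrite (dvdn_trans _ (dvdn_mulr p k_x)) // -{2}Dk dvdn_mulr.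
by rewrite totient_mul_prime_dvd ?(dvdn_trans p_k) // mulnA Dk.
Qed.

(** A prime [p] dividing [t] multiplies the totient by [p] if it divides [m], and otherwise by
    [p.-1], where [p > 2] because [m] is even. Either way the totient at least doubles. *)
Lemma totient_even_max (m t : nat) : (0 < m)%N -> ~~ odd m -> (0 < t)%N ->
  (totient (m * t) <= totient m)%N -> t = 1.
Proof.
move=> m_gt0 even_m t_gt0 le_t; apply/eqP; rewrite eqn_leq t_gt0 andbT leqNgt.
apply/negP => t_gt1.
have [p_pr p_t] := (pdiv_prime t_gt1, pdiv_dvd t).
set p := pdiv t in p_pr p_t; have p_gt1 := prime_gt1 p_pr.
have Dt := divnK p_t.
have tp_gt0 : (0 < t %/ p)%N by rewrite divn_gt0 ?prime_gt0 // dvdn_leq.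
have mp_gt0 : (0 < m * p)%N by rewrite muln_gt0 m_gt0 prime_gt0.
have le_mp : (totient (m * p) <= totient m)%N.
  have Dmt : (m * t = m * p * (t %/ p))%N by rewrite -mulnA [(p * _)%N]mulnC Dt.
  apply: leq_trans le_t; rewrite Dmt dvdn_leq //.
    by rewrite totient_gt0 muln_gt0 mp_gt0 tp_gt0.
  exact: totient_dvd_mul.
have tm_gt0 : (0 < totient m)%N by rewrite totient_gt0.
have [p_m|p_m] := boolP (p %| m)%N.
  by move: le_mp; rewrite totient_mul_prime_dvd //; nia.
have p_gt2 : (2 < p)%N.
  rewrite ltn_neqAle p_gt1 andbT; apply: contraNneq p_m => <-.
  by rewrite dvdn2.
move: le_mp; rewrite totient_mul_prime_ndvd //; nia.
Qed.

(** Cauchy's theorem gives a subgroup of prime order [p] dividing [n]; a subgroup of order [n %/ p]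
    of the quotient, found by induction, is pulled back. *)
Lemma abelian_subgroup_card (gT : finGroupType) (G : {group gT}) (n : nat) :
  abelian G -> (n %| #|G|)%N -> exists2 H : {group gT}, H \subset G & #|H| = n.
Proof.
elim/ltn_ind: n gT G => n IHn gT G abG n_G.
have n_gt0 := dvdn_gt0 (cardG_gt0 G) n_G.
have [n_le1|n_gt1] := leqP n 1.
  exists 1%G; rewrite ?sub1G // cards1.
  by apply/eqP; rewrite eqn_leq n_le1 n_gt0.
have [p_pr p_n] := (pdiv_prime n_gt1, pdiv_dvd n).
set p := pdiv n in p_pr p_n; have p_gt0 := prime_gt0 p_pr.
have [x Gx ox] := Cauchy p_pr (dvdn_trans p_n n_G).
have sxG : <[x]>%g \subset G by rewrite cycle_subG.
have nxG : G \subset 'N(<[x]>)%g by rewrite sub_abelian_norm.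
have oGx : #|(G / <[x]>)%g| = (#|G| %/ p)%N.
  by rewrite card_quotient // -divgS // -orderE ox.
have [|||H sHG oH] := IHn (n %/ p)%N _ _ (G / <[x]>)%G.
- by rewrite ltn_Pdiv // prime_gt1.
- exact: quotient_abelian.
- by rewrite /= oGx -(@dvdn_pmul2r p) // !divnK // (dvdn_trans p_n).
have nsxG : (<[x]> <| G)%g by rewrite /normal sxG.
have [K DK sxK sKG] := inv_quotientS nsxG sHG.
exists K => //.
have nxK : (<[x]> <| K)%g by rewrite /normal sxK (subset_trans sKG).
rewrite -(Lagrange sxK) -orderE ox -card_quotient ?normal_norm // -DK oH.
by rewrite mulnC divnK.
Qed.

(* All conjugates of [(eta - 1) / 3] lie in the open unit disc. *)
Lemma unity_root_mod3 (eta : algC) (m : nat) : (0 < m)%N -> eta ^+ m = 1 ->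
  (eta - 1) / 3 \in Aint -> eta = 1.
Proof.
move=> m_gt0 eta_m Aa; set a := (eta - 1) / 3 in Aa.
have three_neq0 : 3 != 0 :> algC by rewrite pnatr_eq0.
have Deta : eta = 3 * a + 1 by rewrite /a mulrC divfK // subrK.
suff a0 : a = 0 by rewrite Deta a0 mulr0 add0r.
have [rs Drs] := closed_field_poly_normal (minCpoly a).
rewrite (monicP (minCpoly_monic a)) scale1r in Drs.
have [F mon_F DF] := Aint_minCpoly Aa.
(* For a conjugate [x] of [a], [3 * x + 1] is again a root of unity, so [x] has absolute value at
   most [2 / 3]. *)
have rs_lt1 x : x \in rs -> `|x| < 1.
  rewrite -root_prod_XsubC -Drs => rx.
  have : (3 * x + 1) ^+ m = 1.
    apply/eqP; rewrite -subr_eq0.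
    pose q : {poly rat} := (3%:P * 'X + 1) ^+ m - 1.
    have qE y : qeval q y = (3 * y + 1) ^+ m - 1.
      rewrite rmorphB rmorphXn rmorphD rmorphM /= map_polyX map_polyC rmorph1 /=.
      by rewrite rmorph_nat !hornerE.
    by rewrite -qE (qeval_conjugate q rx) qE -Deta eta_m subrr.
  move/(congr1 (fun y : algC => `|y|)); rewrite normr1 normrX => /eqP.
  rewrite pexpr_eq1 // => /eqP norm1.
  have : 3 * `|x| <= 2.
    have -> : 3 * `|x| = `|(3 * x + 1) - 1| by rewrite addrK normrM normr_nat.
    by rewrite (le_trans (ler_normB _ _)) // norm1 normr1.
  rewrite mulrC -ler_pdivlMr ?ltr0n // => /le_lt_trans; apply.
  by rewrite ltr_pdivrMr ?ltr0n // mul1r ltr_nat.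
(* Up to sign this integer is the product of the conjugates, of absolute value below 1. *)
have F0 : F`_0 = 0.
  have rs_gt0 : (0 < size rs)%N.
    by have := size_minCpoly a; rewrite Drs size_prod_XsubC.
  have : `|(F`_0)%:~R : algC| < 1.
    rewrite -coef_map -DF Drs -horner_coef0 horner_prod normr_prod.
    case: (rs) rs_gt0 rs_lt1 => // x rs' _ rs_lt1.
    rewrite big_cons !hornerE normrN.
    apply: le_lt_trans (rs_lt1 x (mem_head _ _)).
    rewrite ler_piMr // big_seq; apply: prodr_ile1 => y y_rs.
    by rewrite normr_ge0 !hornerE normrN ltW // rs_lt1 // inE y_rs orbT.
  by rewrite -intr_norm ltrz1 => F0; apply/eqP; rewrite -normr_le0; lia.
have root0 : root (minCpoly a) 0.
  by rewrite DF rootE horner_coef0 coef_map F0.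
have := qeval_conjugate 'X root0; rewrite map_polyX !hornerX eqxx.
by move/esym/eqP.
Qed.

(** If [l] is the leading coefficient of [p0], of degree [d], then [l * x] is a root of the monic
    integer polynomial [l ^ (d - 1) * p0('X / l)]. *)
Lemma Aint_multiple (x : algC) : exists2 n, (0 < n)%N & n%:R * x \in Aint.
Proof.
have [p [Dp mon_p] dvd_p] := minCpolyP x.
have [p0 [a nz_a Dp0]] := rat_poly_scale p.
have nz_p0 : p0 != 0.
  apply: contraTneq mon_p => p00.
  by rewrite Dp0 p00 rmorph0 scaler0 monicE lead_coef0 eq_sym oner_eq0.
have p0x : zeval p0 x = 0.
  apply/eqP; rewrite zeval_qeval; have := root_minCpoly x.
  rewrite Dp Dp0 map_polyZ rootZ ?rootE // fmorphV rmorph_int /=.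
  by rewrite invr_eq0 intr_eq0.
pose l := lead_coef p0; pose d := (size p0).-1.
have d_gt0 : (0 < d)%N.
  rewrite /d -subn1 subn_gt0.
  have <- : size p = size p0.
    rewrite Dp0 size_scale ?invr_eq0 ?intr_eq0 // size_map_poly_id0 //.
    by rewrite intr_eq0 lead_coef_eq0.
  by rewrite -(size_map_poly (ratr : {rmorphism rat -> algC})) -Dp size_minCpoly.
have nz_l : l != 0 by rewrite lead_coef_eq0.
pose q0 : {poly int} := \poly_(i < d) (p0`_i * l ^+ (d.-1 - i)).
pose q : {poly int} := 'X^d + q0.
have sz_r : (size q0 < size ('X^d : {poly int}))%N.
  by rewrite size_polyXn ltnS size_poly.
have mon_q : q \is monic by rewrite monicE lead_coefDl // lead_coefXn.
have Alx : l%:~R * x \in Aint.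
  apply: (@root_monic_Aint (map_poly intr q)); last first.
  - by apply/polyOverP => i; rewrite coef_map rpred_int.
  - by rewrite monic_map.
  apply/rootP; rewrite rmorphD /= map_polyXn hornerD hornerXn.
  have -> : zeval q0 (l%:~R * x)
       = \sum_(i < d) ((p0`_i)%:~R) * l%:~R ^+ d.-1 * x ^+ i.
    rewrite (horner_coef_wide _ (n := d)); last first.
      by rewrite (leq_trans (size_poly _ _)) // size_poly.
    apply: eq_bigr => i _; rewrite coef_map coef_poly ltn_ord /= rmorphM rmorphXn /=.
    rewrite exprMn -!mulrA; congr (_ * _); rewrite mulrA -exprD subnK //.
    by rewrite -ltnS prednK.
  have := p0x; rewrite (horner_coef_wide _ (n := d.+1)); last first.
    by rewrite (leq_trans (size_poly _ _)) // /d prednK // size_poly_gt0.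
  rewrite big_ord_recr /= coef_map -/(lead_coef p0) -/l => sum0.
  have -> : (l%:~R * x) ^+ d = l%:~R ^+ d.-1 * (l%:~R * x ^+ d) :> algC.
    by rewrite exprMn mulrA -exprSr prednK.
  rewrite -[RHS](mulr0 (l%:~R ^+ d.-1)) -[X in _ = _ * X]sum0 mulrDr [RHS]addrC.
  rewrite mulr_sumr; congr (_ + _).
  by apply: eq_bigr => i _; rewrite coef_map /=; ring.
exists `|l|%N; first by rewrite absz_gt0.
by rewrite pmulrn abszEsg rmorphM /= -mulrA rpredM ?Aint_int.
Qed.

(** * Subrings of fields as integral domains *)

Section SubringDomain.

Variables (E : fieldType) (S : {pred E}).

Definition subring_of of subring_closed S : Type := {x : E | x \in S}.

Hypothesis closedS : subring_closed S.

Local Notation A := (subring_of closedS).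

Definition sr_val (x : A) : E := sval x.

HB.instance Definition _ := [isSub of A for sr_val].
HB.instance Definition _ := [Choice of A by <:].
HB.instance Definition _ :=
  GRing.SubChoice_isSubComNzRing.Build E S A closedS.

Definition sr_unit : {pred A} := fun x => (sr_val x != 0) && ((sr_val x)^-1 \in S).

Definition sr_inv (x : A) : A :=
  if sr_unit x then insubd x (sr_val x)^-1 else x.

Lemma sr_mulVx : {in sr_unit, left_inverse 1 sr_inv *%R}.
Proof.
move=> x Ux; have Ux' : sr_unit x := Ux.
rewrite /sr_inv Ux'; apply: val_inj; have /andP[nz_x SVx] := Ux'.
by rewrite rmorphM rmorph1 /= insubdK // mulVf.
Qed.

Lemma sr_unitPl (x y : A) : y * x = 1 -> sr_unit x.
Proof.
move/(congr1 val); rewrite rmorphM rmorph1 /= => yx1.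
have nz_x : sr_val x != 0.
  by apply: contra_eq_neq yx1 => ->; rewrite mulr0 eq_sym oner_eq0.
rewrite /sr_unit nz_x /=.
have -> : (sr_val x)^-1 = sr_val y by apply: (mulIf nz_x); rewrite mulVf.
exact: (valP y).
Qed.

Lemma sr_inv_out : {in [predC sr_unit], sr_inv =1 id}.
Proof.
move=> x nUx; have /negPf nUx' : ~~ sr_unit x := nUx.
by rewrite /sr_inv nUx'.
Qed.

HB.instance Definition _ :=
  GRing.ComNzRing_hasMulInverse.Build A sr_mulVx sr_unitPl sr_inv_out.

Lemma sr_mulf_eq0 (x y : A) : x * y = 0 -> (x == 0) || (y == 0).
Proof.
move/(congr1 val)/eqP; rewrite rmorphM rmorph0 mulf_eq0.
by rewrite -!(inj_eq val_inj) rmorph0.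
Qed.

HB.instance Definition _ := GRing.ComUnitRing_isIntegral.Build A sr_mulf_eq0.

End SubringDomain.

Lemma subring_domain (E : fieldType) (S : {pred E}) : subring_closed S ->
  exists (A : idomainType) (f : {rmorphism A -> E}),
    [/\ injective f, forall x, f x \in S & forall y, y \in S -> exists x, f x = y].
Proof.
move=> closedS; exists (subring_of closedS : idomainType).
exists (val : {rmorphism subring_of closedS -> E}).
split=> [|x|y Sy]; [exact: val_inj | exact: (valP x) |].
by exists (exist _ y Sy).
Qed.

(** * Subfields of cyclotomic fields *)

Lemma dim_prim_root (Qn : fieldExtType rat) (QnC : {rmorphism Qn -> algC})
    (m : nat) (y : Qn) :
  m.-primitive_root y -> \dim <<1; y>>%VS = totient m.
Proof.
rewrite -(fmorph_primitive_root QnC) => prim_y.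
by rewrite -(size_minCpoly_minPoly QnC) (minCpoly_cyclotomic prim_y) size_cyclotomic.
Qed.

Lemma gal_horner (Qn : splittingFieldType rat) (x : gal_of {:Qn})
    (q : {poly rat}) (y : Qn) :
  x (map_poly (in_alg Qn) q).[y] = (map_poly (in_alg Qn) q).[x y].
Proof.
rewrite -horner_map -map_poly_comp; congr horner; apply: eq_map_poly => a /=.
by rewrite linearZ /= rmorph1.
Qed.

(** Automorphisms raise the generator [eps] to powers, and these operations commute. *)
Lemma cyclotomic_abelian (Qn : splittingFieldType rat) (m : nat) (eps : Qn) :
    m.-primitive_root eps -> <<1; eps>>%VS = fullv ->
  abelian 'Gal({:Qn} / 1).
Proof.
move=> prim_eps gen_eps; apply/centsP => x _ y _.
apply/eqP/gal_eqP => a _; have : a \in <<1; eps>>%VS by rewrite gen_eps memvf.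
case/Fadjoin_polyP=> p /polyOver1P[q ->] ->.
rewrite !galM ?memvf // !gal_horner; congr _.[_].
have pow (u : gal_of {:Qn}) : exists i : 'I_m, u eps = eps ^+ i.
  have : u eps ^+ m = 1 by rewrite -rmorphXn (prim_expr_order prim_eps) rmorph1.
  by move/(prim_rootP prim_eps)=> [i ->]; exists i.
have [i Dx] := pow x; have [j Dy] := pow y.
by rewrite Dx Dy !rmorphXn /= Dx Dy -!exprM mulnC.
Qed.

(** [K] is the fixed field of a subgroup of index [k] in the abelian Galois group over [Q(zeta)] of
    the field of [M]-th roots of unity. *)
Lemma cyclotomic_subfield (N k : nat) : (0 < N)%N -> (0 < k)%N ->
  exists (Qn : splittingFieldType rat) (QnC : {rmorphism Qn -> algC})
    (zeta : Qn) (K : {subfield Qn}),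
    [/\ galois 1 {:Qn},
        forall x : gal_of {:Qn}, exists nu : {rmorphism algC -> algC},
          forall a, QnC (x a) = nu (QnC a),
        N.-primitive_root zeta, zeta \in K
      & \dim K = (k * totient N)%N].
Proof.
(* The second factor [k] makes [k] divide the relative degree: [totient (N * k * k) = k * totient (N
   * k)], and [totient N] divides [totient (N * k)]. *)
move=> N_gt0 k_gt0; pose M := (N * k * k)%N.
have M_gt0 : (0 < M)%N by rewrite !muln_gt0 N_gt0 k_gt0.
have [Qn galQn [QnC gQnC [eps [prim_eps gen_eps] _]]] :=
  group_num_field_exists [set: 'I_M.-1.+1]%G.
rewrite /= cardsT card_ord prednK // in prim_eps.
have N_M : (N %| M)%N by rewrite /M -mulnA dvdn_mulr.
pose zeta := eps ^+ (M %/ N).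
have prim_zeta : N.-primitive_root zeta by apply: dvdn_prim_root.
pose K0 := <<1; zeta>>%AS; pose H1 := 'Gal({:Qn} / K0)%G.
have dimQn : \dim {:Qn} = totient M by rewrite -gen_eps (dim_prim_root QnC prim_eps).
have dimK0 : \dim K0 = totient N by rewrite (dim_prim_root QnC prim_zeta).
have galK0 : galois K0 {:Qn} by apply: galoisS galQn; rewrite sub1v subvf.
have oH1 : (#|H1| * totient N)%N = totient M.
  by rewrite -dimK0 -dimQn -(galois_dim galK0) -dim_sup_field // subvf.
have abH1 : abelian H1.
  apply: abelianS (cyclotomic_abelian prim_eps gen_eps).
  by apply: galS; rewrite sub1v.
have k_H1 : (k %| #|H1|)%N.
  have tN_gt0 : (0 < totient N)%N by rewrite totient_gt0.
  have Nk_gt0 : (0 < N * k)%N by rewrite muln_gt0 N_gt0.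
  rewrite -(dvdn_pmul2r tN_gt0) oH1 /M (totient_mul_dvd Nk_gt0 (dvdn_mull _ _)) //.
  by rewrite dvdn_pmul2l // totient_dvd_mul.
have [H sHH1 oH] := abelian_subgroup_card abH1 (dvdn_div k_H1).
have sK0K : (K0 <= fixedField H)%VS.
  apply: subv_trans (fixedFieldS sHH1); exact: galois_connection_subv (subvf _).
exists Qn, QnC, zeta, (fixedField_aspace H); split=> //.
- by move=> x; have [nu Dnu] := gQnC x; exists nu => a; rewrite -Dnu.
- exact: subvP sK0K _ (memv_adjoin _ _).
have : (\dim (fixedField H) * #|H|)%N = totient M.
  rewrite (dim_fixedField H) -dimQn mulnC.
  by rewrite [RHS](@dim_sup_field _ _ (fixedField_aspace H) {:Qn}%AS) ?capvSl.
rewrite -oH1 -(divnK k_H1) -oH -mulnA mulnC => /eqP.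
by rewrite eqn_pmul2l ?cardG_gt0 // => /eqP.
Qed.

(** A positive multiple of a separable generator is integral. The factor 3 will place it in the
    congruence ring, by [triple_congruence]. *)
Lemma integral_generator (Qn : splittingFieldType rat)
    (QnC : {rmorphism Qn -> algC}) (K : {subfield Qn}) :
  exists2 a : Qn, QnC a \in Aint & <<1; a *+ 3>>%VS = K.
Proof.
have sepK : separable 1 K.
  apply/separableP => y _; apply: pcharf0_separable => p.
  by rewrite -(fmorph_pchar QnC) pchar_num.
have gen_K := eq_adjoin_separable_generator sepK (sub1v K).
set y := separable_generator 1 K in gen_K.
have [n n_gt0 An] := Aint_multiple (QnC y).
exists (y *+ n); first by rewrite rmorphMn /= -mulr_natl.
rewrite -mulrnA gen_K; apply/eqP; rewrite eqEsubv.
have n3_neq0 : (n * 3)%:R != 0 :> Qn.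
  rewrite -(fmorph_eq0 QnC) rmorph_nat pnatr_eq0 muln_eq0 negb_or -lt0n n_gt0.
  by [].
apply/andP; split; apply/FadjoinP; split; rewrite ?sub1v //.
  by rewrite rpredMn // memv_adjoin.
have Dy : y = y *+ (n * 3) / (n * 3)%:R by rewrite -[_ *+ _]mulr_natr mulfK.
by rewrite {1}Dy rpred_div ?rpred_nat // memv_adjoin.
Qed.

(** * Integers congruent to their conjugates modulo 3 *)

Section CongruenceRing.

Variables (Qn : splittingFieldType rat) (QnC : {rmorphism Qn -> algC}).
Variables (zeta : Qn) (K : {subfield Qn}).
Hypothesis galQn : galois 1 {:Qn}.
Hypothesis gQnC : forall x : gal_of {:Qn}, exists nu : {rmorphism algC -> algC},
  forall a, QnC (x a) = nu (QnC a).

(* Contains three times the integers of [K], hence has as many independent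
   units as they do, but no root of unity outside [Q(zeta)]. *)
Definition congruence_ring : {pred Qn} := fun y =>
  [&& y \in K, QnC y \in Aint
    & [forall x in 'Gal({:Qn} / <<1; zeta>>)%g, QnC (x y - y) / 3 \in Aint]].

Lemma gal_Aint (x : gal_of {:Qn}) (a : Qn) :
  (QnC (x a) \in Aint) = (QnC a \in Aint).
Proof. by have [nu ->] := gQnC x; rewrite Aint_aut. Qed.

Lemma congruence_ring_closed : subring_closed congruence_ring.
Proof.
split=> [|a b /and3P[Ka Aa /forall_inP ga] /and3P[Kb Ab /forall_inP gb]
         |a b /and3P[Ka Aa /forall_inP ga] /and3P[Kb Ab /forall_inP gb]].
- apply/and3P; split; rewrite ?rpred1 ?rmorph1 //.
  by apply/forall_inP => x _; rewrite rmorph1 subrr rmorph0 mul0r.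
- apply/and3P; split; rewrite ?rpredB ?rmorphB ?rpredB //.
  apply/forall_inP => x gx.
  have -> : x (a - b) - (a - b) = (x a - a) - (x b - b).
    by rewrite rmorphB /=; ring.
  by rewrite rmorphB mulrBl rpredB ?ga ?gb.
- apply/and3P; split; rewrite ?rpredM ?rmorphM ?rpredM //.
apply/forall_inP => x gx.
have -> : x (a * b) - a * b = x a * (x b - b) + (x a - a) * b.
  by rewrite rmorphM /=; ring.
rewrite rmorphD !rmorphM mulrDl -mulrA [X in _ + X]mulrAC.
by apply: rpredD; apply: rpredM; rewrite ?gal_Aint //; [exact: gb | exact: ga].
Qed.

Lemma zeta_congruence : zeta \in K -> QnC zeta \in Aint -> zeta \in congruence_ring.
Proof.
move=> Kz Az; apply/and3P; split=> //; apply/forall_inP => x gx.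
by rewrite (fixed_gal (subvf _) gx) ?memv_adjoin // subrr rmorph0 mul0r.
Qed.

Lemma triple_congruence (a : Qn) : a *+ 3 \in K -> QnC a \in Aint ->
  a *+ 3 \in congruence_ring.
Proof.
move=> Ka Aa; apply/and3P; split=> //; first by rewrite rmorphMn rpredMn.
apply/forall_inP => x _; rewrite rmorphMn -mulrnBl rmorphMn /= -mulr_natr mulfK.
  by rewrite rmorphB rpredB ?gal_Aint.
by rewrite pnatr_eq0.
Qed.

(** For [x] in the Galois group, [x y / y] is a root of unity congruent to 1 modulo 3, hence 1. So
    [y] is fixed by the whole group over [Q(zeta)]. *)
Lemma congruence_torsion (m : nat) (y : Qn) :
  y \in congruence_ring -> m.-primitive_root y -> (y \in <<1; zeta>>)%VS.
Proof.
move=> /and3P[_ _ /forall_inP gy] prim_y.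
have m_gt0 := prim_order_gt0 prim_y.
have nz_y : y != 0 by rewrite (prim_root_eq0 prim_y) -lt0n.
have galz : galois <<1; zeta>> {:Qn} by apply: galoisS galQn; rewrite sub1v subvf.
have /galois_fixedField <- := galz.
apply/fixedFieldP; rewrite ?memvf // => x gx.
have Ay : QnC y^-1 \in Aint.
  apply: (@Aint_unity_root m); rewrite ?m_gt0 //; apply/unity_rootP.
  by rewrite -rmorphXn exprVn (prim_expr_order prim_y) invr1 rmorph1.
have eta1 : QnC (x y / y) = 1.
  apply: (@unity_root_mod3 _ m m_gt0).
    rewrite -rmorphXn expr_div_n -rmorphXn (prim_expr_order prim_y) !rmorph1 divr1.
    by rewrite rmorph1.
  have -> : (QnC (x y / y) - 1) / 3 = QnC (x y - y) / 3 * QnC y^-1.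
    by rewrite [RHS]mulrAC -rmorphM [(x y - y) * _]mulrBl divff // rmorphB rmorph1.
  by rewrite rpredM ?gy.
move/eqP: eta1; rewrite fmorph_eq1 => /eqP xyy.
by rewrite -[LHS](divfK nz_y) xyy mul1r.
Qed.

End CongruenceRing.

Lemma units_backward (n g : nat) :
    (1 <= n)%N -> (totient (2 * n) %| 2 * (g + 1))%N ->
  exists A : idomainType,
    [/\ [pchar A] =i pred0, integral_over_Z A, finitely_generated (unit_group A)
      & isomorphic (unit_group A) (C2n_Zg n g)].
Proof.
move=> n_gt0; set N := (2 * n)%N => tN_dvd.
have N_gt1 : (1 < N)%N by rewrite /N; lia.
have N_gt0 : (0 < N)%N := ltnW N_gt1.
have even_N : ~~ odd N by rewrite /N oddM.
(* For [N = 2] the field is built on a root of unity of order 4, to be totally complex;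
   [totient 4 = 2] divides [2 * (g + 1)]. *)
have [N' [N'_gt2 N_N' tN'_dvd]] :
    exists N', [/\ (2 < N')%N, (N %| N')%N & (totient N' %| 2 * (g + 1))%N].
  have [N_gt2|N_le2] := ltnP 2 N; first by exists N.
  exists 4; split=> //; last by rewrite dvdn_mulr.
  have -> : N = 2 by rewrite /N; move: n_gt0 N_le2; rewrite /N; lia.
  by [].
pose k := (2 * (g + 1) %/ totient N')%N.
have N'_gt0 : (0 < N')%N := ltn_trans (isT : (0 < 2)%N) N'_gt2.
have kE : (k * totient N' = 2 * (g + 1))%N by rewrite divnK.
have k_gt0 : (0 < k)%N by move: kE; case: (k) => //; rewrite mul0n addn1.
have [Qn [QnC [zeta' [K [galQn gQnC prim_zeta' Kzeta' dimK]]]]] :=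
  cyclotomic_subfield N'_gt0 k_gt0.
(* Congruences are taken over the field of [zeta], of order [N] and not [N']; for [N = 2] this
   leaves only the roots of unity 1 and -1. *)
pose zeta := zeta' ^+ (N' %/ N).
have prim_zeta : N.-primitive_root zeta by apply: dvdn_prim_root.
have Kzeta : zeta \in K by rewrite rpredX.
have [a Aa gen_K] := integral_generator QnC K; set theta := a *+ 3 in gen_K.
have [A [f [f_inj f_S f_surj]]] :=
  subring_domain (congruence_ring_closed zeta K gQnC).
pose F := QnC \o f : {rmorphism A -> algC}.
have F_inj : injective F by apply: inj_comp f_inj; apply: fmorph_inj.
have AF x : F x \in Aint by have /and3P[] := f_S x.
have F_zeval (p : {poly int}) x : F (map_poly intr p).[x] = zeval p (F x).
  rewrite -horner_map -map_poly_comp; congr horner; apply: eq_map_poly => b.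
  exact: rmorph_int.
have [xtheta Dtheta] : exists x, f x = theta.
  apply/f_surj/triple_congruence => //.
  by rewrite -gen_K memv_adjoin.
have [xzeta Dzeta] : exists x, f x = zeta.
  apply/f_surj/zeta_congruence => //.
  by apply: (@Aint_prim_root N); rewrite fmorph_primitive_root.
(* [theta] lies in the ring and generates [K]: the units of [A] lie between those of [Z[z]] and
   those of the integers of [K], as [unit_rank] requires. *)
pose z := QnC theta.
have Fxtheta : F xtheta = z by rewrite /= Dtheta.
have Az : z \in Aint by rewrite -Fxtheta.
have K_poly y : y \in K -> exists q, qeval q z = QnC y.
  rewrite -gen_K => /Fadjoin_polyP[p /polyOver1P[q ->] ->].
  by exists q; rewrite fmorph_qeval.
have intA : integral_over_Z A.
  split=> [b c eq_bc|x].
    by apply: (@intr_inj algC); rewrite -!(rmorph_int F) eq_bc.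
  have [G mon_G DG] := Aint_minCpoly (AF x); exists G => //.
  apply/rootP/F_inj; rewrite F_zeval rmorph0; apply/rootP.
  by rewrite -DG root_minCpoly.
pose phi (u : add_unit A) := F (auval u).
have phi0 : phi 0 = 1 by rewrite /phi auval0 rmorph1.
have phiD : {morph phi : u v / u + v >-> u * v}.
  by move=> u v; rewrite /phi auvalD rmorphM.
have phi_inj : injective phi by move=> u v /F_inj/auval_inj.
have phi_poly u : exists p : {poly rat}, qeval p z == phi u.
  have /and3P[Ku _ _] := f_S (auval u); have [q Dq] := K_poly _ Ku.
  by exists q; apply/eqP.
have phi_units (p q : {poly int}) : zeval p z * zeval q z = 1 ->
    exists v, phi v = zeval p z.
  rewrite -Fxtheta -!F_zeval -rmorphM => pq1.
  have Up : (map_poly intr p).[xtheta] \is a GRing.unit.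
    apply/unitrP; exists (map_poly intr q).[xtheta]; rewrite mulrC.
    by split; apply: F_inj; rewrite pq1 rmorph1.
  by exists (UnitGroup Up : add_unit A).
have [q' Dq'] := K_poly _ Kzeta'.
have prim_q' : N'.-primitive_root (qeval q' z) by rewrite Dq' fmorph_primitive_root.
have [r [w Dz]] := half_roots_exist (nonreal_conjugates prim_q' N'_gt2).
have Dr : r = g.
  have := size_minCpoly_minPoly QnC theta.
  rewrite (size_minCpoly_half Dz) gen_K dimK kE addn1 /= => /eqP.
  by rewrite eqn_pmul2l // eqSS => /eqP.
have [fgA ind_r max_r] :=
  unit_rank Az Dz phi0 phiD phi_inj (fun u => AF (auval u)) phi_poly phi_units.
have [m [g' [t [b [prim_t ind_b tors_t gen]]]]] :=
  fg_field_structure fgA phi0 phiD phi_inj.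
have m_gt0 := prim_order_gt0 prim_t.
have tm : t *+ m = 0.
  by apply: phi_inj; rewrite (phi_muln phi0 phiD) prim_expr_order.
have Dg' : g' = g by rewrite -Dr; apply: (rank_unique m_gt0 tm ind_b gen ind_r max_r).
have N_m : (N %| m)%N.
  have Uzeta : xzeta \is a GRing.unit.
    apply/unitrP; exists (xzeta ^+ N.-1); rewrite -exprS -exprSr prednK //.
    by split; apply: f_inj; rewrite rmorphXn /= Dzeta prim_expr_order ?rmorph1.
  pose u : add_unit A := UnitGroup Uzeta.
  have phi_u : phi u = QnC zeta by rewrite /phi /= Dzeta.
  have prim_u : N.-primitive_root (phi u) by rewrite phi_u fmorph_primitive_root.
  have [|j Du] := tors_t u.
    exists N => //; apply: phi_inj.
    by rewrite (phi_muln phi0 phiD) (prim_expr_order prim_u).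
  rewrite (prim_order_dvd prim_u) -(phi_muln phi0 phiD) Du -mulrnA mulnC mulrnA.
  by rewrite tm mul0rn phi0.
(* [N] divides [m], and the torsion generator lies in [Q(zeta)], so that [totient m <= totient N];
   [totient_even_max] concludes since [N] is even. *)
have Dm : m = N.
  have prim_ft : m.-primitive_root (f (auval t)).
    by rewrite -(fmorph_primitive_root QnC).
  have ft_zeta := congruence_torsion galQn (f_S (auval t)) prim_ft.
  have le_t : (totient m <= totient N)%N.
    rewrite -(dim_prim_root QnC prim_ft) -(dim_prim_root QnC prim_zeta).
    by apply: dimvS; apply/FadjoinP; rewrite sub1v.
  have Dm : m = (N * (m %/ N))%N by rewrite mulnC divnK.
  have t1 : (m %/ N)%N = 1%N.
    apply: (totient_even_max N_gt0 even_N); last by rewrite -Dm.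
    by rewrite divn_gt0 // dvdn_leq.
  by rewrite Dm t1 muln1.
exists A; split=> //.
- by move=> p; apply/negP => /(rmorph_pchar F); rewrite pchar_num.
- exact/fg_add_unit.
subst g'; rewrite Dm in prim_t.
have [h bij_h hD] := structure_bijection phi0 phiD phi_inj N_gt1 prim_t ind_b gen.
exact: add_unit_isomorphic bij_h hD.
Qed.

Theorem proposition3p3 (G : groupType) :
  [/\ commutative_group G, finitely_generated G & realizable G] <->
  exists n g : nat,
    [/\ (1 <= n)%N, (totient (2 * n) %| 2 * (g + 1))%N
      & isomorphic G (C2n_Zg n g)].
Proof.
split=> [[_ fgG [A [_ intA isoAG]]]|[n [g [n_gt0 tn_dvd isoG]]]].
  have isoGA := isomorphic_sym isoAG.
  have [n [g [n_gt0 tn_dvd isoA]]] := units_forward intA (isomorphic_fg isoGA fgG).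
  by exists n, g; split=> //; apply: isomorphic_trans isoGA isoA.
have [A [charA intA fgA isoA]] := units_backward n_gt0 tn_dvd.
have isoAG := isomorphic_trans isoA (isomorphic_sym isoG).
split; last by exists A.
  apply: isomorphic_commutative isoAG _ => x y; exact: ug_mulC.
exact: isomorphic_fg isoAG fgA.
Qed.
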